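(* Let $\varepsilon,a>0$ be constants and let $h\in C^3(\mathbb{R})$ satisfy $h'(x)x>0$ for all $x\ne 0$, $h'(0)=0$ and $h''(0)>0$. Consider the scalar system $$\dot x(t)=-\varepsilon\sin(t)\,h\big(x(t)+a\sin(t)\big),\qquad x(t)\in\mathbb{R}. \quad (\ast)$$ Then for every bounded solution $x(t)$ of $(\ast)$ there exists a $2\pi$-periodic solution $x^*(t)$ of $(\ast)$ such that $\lim_{t\to+\infty}\left(|x(t)-x^*(t)|\right)=0$. Furthermore, suppose that $a\le 1$ and that for a certain $R>0$ the following inequalities hold: $$a\gamma\left(12\sigma h''(0)+(\gamma+6\sigma)^2\right)<18\sigma^2h''(0)\pi,\qquad a^2\gamma<6\sigma R,$$ where $$\sigma:=\inf\left\{\frac{wh'(w)}{w^2}:0<|w|\le 2R+1\right\}=\min\left\{\int_0^1h''(\lambda w)\,d\lambda:|w|\le 2R+1\right\}>0,\qquad \gamma:=\max_{|z|\le 2R+2}\left(|h'''(z)|\right).$$ Then there exists $\varepsilon^*>0$ such that the following property holds for every $\varepsilon\in(0,\varepsilon^* )$: there exists a unique $2\pi$-periodic solution $x^{**}(t)$ of $(\ast)$ with $$\max_{t\in[0,2\pi]}\left(|x^{**}(t)|\right)\le\frac{a^2\gamma}{6\sigma}+\varepsilon K,\qquad K:=8\max_{|z|\le 2R+2}\left(|h(z)|\right)\left(\frac{2}{a\sigma}\max_{|z|\le 3R+2}\left(|h'(z)|\right)+1\right),$$ such that for every $t_0\ge 0$, $x_0\in\mathbb{R}$ with $|x_0|\le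 R$, the unique solution $x(t)$ of $(\ast)$ with initial condition $x(t_0)=x_0$ is defined for $t\ge t_0$ and satisfies $\lim_{t\to+\infty}\left(|x(t)-x^{**}(t)|\right)=0$.
   Context: $C^3(\mathbb{R})$ is the class of three times continuously differentiable real-valued functions on $\mathbb{R}$. A bounded solution of $(\ast)$ means a solution, with some initial time $t_0\ge 0$, that is defined for all $t\ge t_0$ and bounded on $[t_0,+\infty)$. A $2\pi$-periodic solution is a solution defined for all $t\ge 0$ and satisfying $x(t+2\pi)=x(t)$ (constant solutions are allowed). *)

(* Defs.v *)
From Stdlib Require Import Reals Lra Lia.
From Coquelicot Require Import Coquelicot.
Open Scope R_scope.

Definition class_C (n : nat) (f : R -> R) : Prop :=
  (forall (k : nat) (x : R), (k <= n)%nat -> ex_derive_n f k x) /\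
  (forall x : R, continuous (Derive_n f n) x).

(* The derivative is taken within D, hence it is one-sided at an end point
   belonging to D; the values of x outside D play no role. *)
Definition is_solution (eps a : R) (h : R -> R) (D : R -> Prop) (x : R -> R)
  : Prop :=
  forall t : R, D t ->
    D_in x (fun s => - eps * sin s * h (x s + a * sin s)) D t.

Definition is_bounded_solution (eps a : R) (h x : R -> R) : Prop :=
  exists t0 : R, 0 <= t0 /\
    is_solution eps a h (fun t => t0 <= t) x /\
    exists M : R, forall t : R, t0 <= t -> Rabs (x t) <= M.

Definition is_periodic_solution (eps a : R) (h x : R -> R) : Prop :=
  is_solution eps a h (fun t => 0 <= t) x /\
  forall t : R, 0 <= t -> x (t + 2 * PI) = x t.

Definition is_max_over (D : R -> Prop) (f : R -> R) (m : R) : Prop :=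
  (exists z : R, D z /\ f z = m) /\ (forall z : R, D z -> f z <= m).

Definition is_min_over (D : R -> Prop) (f : R -> R) (m : R) : Prop :=
  (exists z : R, D z /\ f z = m) /\ (forall z : R, D z -> m <= f z).

(* A total operator: the supremum, which is the maximum as soon as a maximum
   exists (max_over_eq), in particular when f is continuous on a segment
   (max_over_segment, max_over_ball). *)
Definition max_over (D : R -> Prop) (f : R -> R) : R :=
  real (Lub_Rbar (fun y => exists z : R, D z /\ y = f z)).

Definition inf_over (D : R -> Prop) (f : R -> R) : R :=
  real (Glb_Rbar (fun y => exists z : R, D z /\ y = f z)).

Definition sigma_h (h : R -> R) (r : R) : R :=
  inf_over (fun w => 0 < Rabs w <= 2 * r + 1)
           (fun w => w * Derive h w / w ^ 2).

Definition gamma_h (h : R -> R) (r : R) : R :=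
  max_over (fun z => Rabs z <= 2 * r + 2) (fun z => Rabs (Derive_n h 3 z)).

Definition K_h (h : R -> R) (a r : R) : R :=
  8 * max_over (fun z => Rabs z <= 2 * r + 2) (fun z => Rabs (h z)) *
  (2 / (a * sigma_h h r) *
     max_over (fun z => Rabs z <= 3 * r + 2) (fun z => Rabs (Derive h z)) + 1).

Lemma max_over_eq (D : R -> Prop) (f : R -> R) (m : R) :
  is_max_over D f m -> max_over D f = m.
Proof.
intros [[z [Dz fz]] Hm].
unfold max_over.
rewrite (is_lub_Rbar_unique _ (Finite m)); [reflexivity|].
split.
- intros y [w [Dw ->]]; simpl; auto.
- intros b Hb; apply Hb; exists z; auto.
Qed.

Lemma max_over_segment (p q : R) (f : R -> R) :
  p <= q ->
  (forall t, p <= t <= q -> continue_in f (fun s => p <= s <= q) t) ->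
  is_max_over (fun t => p <= t <= q) f (max_over (fun t => p <= t <= q) f).
Proof.
intros Hpq Hc.
set (c := fun t => Rmax p (Rmin q t)).
assert (Hcr : forall t, p <= c t <= q).
{ intros t; unfold c, Rmax, Rmin.
  destruct (Rle_dec q t); destruct (Rle_dec p _); lra. }
assert (Hci : forall t, p <= t <= q -> c t = t).
{ intros t Ht; unfold c, Rmax, Rmin.
  destruct (Rle_dec q t); destruct (Rle_dec p _); lra. }
assert (Hcl : forall s t, Rabs (c s - c t) <= Rabs (s - t)).
{ intros s t; unfold c, Rmax, Rmin.
  destruct (Rle_dec q s); destruct (Rle_dec q t);
  repeat destruct (Rle_dec p _); unfold Rabs; 
  repeat destruct (Rcase_abs _); lra. }
destruct (continuity_ab_maj (fun t => f (c t)) p q Hpq) as [m [Hm1 Hm2]].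
{ intros t Ht e He.
  destruct (Hc (c t) (Hcr t) e He) as [d [Hd Hf]].
  exists d; split; [exact Hd|].
  intros s [_ Hs]; simpl in *.
  destruct (Req_dec (c t) (c s)) as [E|E].
  - rewrite E, R_dist_eq; exact He.
  - apply Hf; repeat split; try apply Hcr; try exact E.
    eapply Rle_lt_trans; [apply Hcl|exact Hs]. }
assert (H : is_max_over (fun t => p <= t <= q) f (f m)).
{ split; [exists m; split; auto|].
  intros z Hz; generalize (Hm1 z Hz); rewrite !Hci; auto. }
rewrite (max_over_eq _ _ _ H); exact H.
Qed.

Lemma max_over_ball (r : R) (f : R -> R) :
  0 <= r -> (forall z, continuous f z) ->
  is_max_over (fun z => Rabs z <= r) f (max_over (fun z => Rabs z <= r) f).
Proof.
intros Hr Hc.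
destruct (continuity_ab_maj f (- r) r) as [m [Hm1 Hm2]]; [lra| |].
{ intros t _; apply continuity_pt_filterlim, Hc. }
assert (H : is_max_over (fun z => Rabs z <= r) f (f m)).
{ split; [exists m; split; [apply Rabs_le; exact Hm2|reflexivity]|].
  intros z Hz; apply Hm1, Rabs_le_between, Hz. }
rewrite (max_over_eq _ _ _ H); exact H.
Qed.

(* Main.v *)
Require Import Defs.
From Stdlib Require Import Reals Ranalysis5 Classical Lra Lia.
From Coquelicot Require Import Coquelicot.
Open Scope R_scope.

(** Convergence of bounded solutions is specific to scalar equations. If x is a
   solution, so is its translate by 2 pi, and two solutions of a scalar
   equation keep their order; hence the samples x(2 pi n) form a monotone
   sequence. If x is bounded they converge, and by Gronwall the translates of x
   by 2 pi n converge, uniformly on a period, to the solution started at the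
   limit of the samples, which is therefore 2 pi-periodic and attracts x
   ([bounded_solution_converges]). That solution comes from Picard iteration
   applied to h precomposed with the projection onto a large ball
   ([picard_lindelof], [clipped_solution]); it stays where the projection acts
   as the identity.

   For the second part, the change of x over one period is computed by
   averaging. Replacing x(t) by its value c at the start of the period costs
   O(eps^2), and a third order Taylor expansion in a sin t leaves
     x(s + 2 pi) - c = - eps (a pi h'(c) + error),
     |error| <= pi a^3 gamma / 6 + 4 pi^2 eps H L,
   where H and L bound |h| and |h'| on the balls used for K. Indeed sin
   and sin^3 integrate to 0 over a period, and sin^2 to pi
   ([period_increment]). Since h'(c) >= sigma c for c >= 0, and symmetrically
   for c <= 0, the point c moves strictly towards 0 as soon as |c| exceeds
     beta = a^2 gamma / (6 sigma) + 4 pi eps H L / (a sigma)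
   ([return_map]). For small eps this traps every solution starting in
   [-R, R] ([trapped_solution]), so that each of them converges to a periodic
   solution, and it forces that periodic solution to have modulus at most
   beta + 2 pi eps H, which is within the announced bound because 4 pi <= 16
   and 2 pi <= 8 ([periodic_attractor_small], [drift_constant]).

   There is a single such periodic solution because the flow contracts there.
   For periodic solutions v < u of modulus at most rho, the quantity
     ln (u - v) - eps cos t (h(u) - h(v)) / (u - v)
   is periodic, but its derivative is at most
     - eps a sin^2 t (h''(0) - gamma rho - gamma a / 2) + O(eps^2);
   the correction term cancels the only part of order eps whose sign varies.
   The hypothesis relating a, gamma, sigma and h''(0) makes the bracket
   positive at rho = a^2 gamma / (6 sigma) ([contraction_margin]), so the
   quantity would decrease over a period ([no_two_periodic_solutions]). *)

(** * Increments bounded by derivatives, Taylor remainders, Gronwall *)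

Lemma Derive_eta (f : R -> R) (x l : R) :
  is_derive f x l -> Derive (fun z : R => f z) x = l.
Proof. exact (is_derive_unique f x l). Qed.

(** The mean value inequality with a varying bound. Averages over a period
    are estimated with it, G being an explicit primitive of the bound. *)
Lemma increment_bound (u du G dG : R -> R) (p q : R) :
  p <= q ->
  (forall t, p <= t <= q -> is_derive u t (du t)) ->
  (forall t, p <= t <= q -> is_derive G t (dG t)) ->
  (forall t, p <= t <= q -> du t <= dG t) ->
  u q - u p <= G q - G p.
Proof.
intros Hpq Hu HG Hle.
destruct (MVT_gen (fun t => u t - G t) p q (fun t => du t - dG t)) as [c [Hc Hm]].
- rewrite Rmin_left, Rmax_right by lra; intros t Ht.
  apply (is_derive_minus u G); [apply Hu | apply HG]; lra.
- rewrite Rmin_left, Rmax_right by lra; intros t Ht.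
  apply continuity_pt_filterlim.
  apply (ex_derive_continuous (fun t => u t - G t)).
  exists (du t - dG t).
  apply (is_derive_minus u G); [apply Hu | apply HG]; lra.
- rewrite Rmin_left, Rmax_right in Hc by lra.
  specialize (Hle c Hc).
  assert ((du c - dG c) * (q - p) <= 0) by nra.
  lra.
Qed.

Lemma increment_abs_bound (u du G dG : R -> R) (p q : R) :
  p <= q ->
  (forall t, p <= t <= q -> is_derive u t (du t)) ->
  (forall t, p <= t <= q -> is_derive G t (dG t)) ->
  (forall t, p <= t <= q -> Rabs (du t) <= dG t) ->
  Rabs (u q - u p) <= G q - G p.
Proof.
intros Hpq Hu HG Hle.
apply Rabs_le; split.
- assert (H : (fun t => - u t) q - (fun t => - u t) p <= G q - G p).
  { apply (increment_bound (fun t => - u t) (fun t => - du t) G dG); auto.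
    - intros t Ht; apply (is_derive_opp u); auto.
    - intros t Ht; specialize (Hle t Ht); apply Rabs_le_between in Hle; lra. }
  simpl in H; lra.
- apply (increment_bound u du G dG); auto.
  intros t Ht; specialize (Hle t Ht); apply Rabs_le_between in Hle; lra.
Qed.

Lemma increment_le_linear (u du : R -> R) (M p q : R) :
  p <= q ->
  (forall t, p <= t <= q -> is_derive u t (du t)) ->
  (forall t, p <= t <= q -> Rabs (du t) <= M) ->
  Rabs (u q - u p) <= M * (q - p).
Proof.
intros Hpq Hu HM.
replace (M * (q - p)) with (M * q - M * p) by ring.
apply (increment_abs_bound u du (fun t => M * t) (fun _ => M)); auto.
intros t _; auto_derive; auto; ring.
Qed.

Lemma lipschitz_on_ball (f f1 : R -> R) (L M : R) :
  (forall z, is_derive f z (f1 z)) ->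
  (forall z, Rabs z <= M -> Rabs (f1 z) <= L) ->
  forall x y, Rabs x <= M -> Rabs y <= M ->
  Rabs (f x - f y) <= L * Rabs (x - y).
Proof.
intros Hf HL.
assert (W : forall x y, x <= y -> Rabs x <= M -> Rabs y <= M ->
  Rabs (f y - f x) <= L * (y - x)).
{ intros x y Hxy Hx Hy; apply (increment_le_linear f f1); auto.
  intros z Hz; apply HL.
  apply Rabs_le_between in Hx; apply Rabs_le_between in Hy; apply Rabs_le; lra. }
intros x y Hx Hy; destruct (Rle_dec x y) as [H|H].
- rewrite (Rabs_minus_sym x y), (Rabs_pos_eq (y - x)), Rabs_minus_sym by lra; auto.
- rewrite (Rabs_pos_eq (x - y)) by lra; apply W; auto; lra.
Qed.

Lemma Rabs_segment (M x u l : R) :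
  Rabs x <= M -> Rabs (x + u) <= M -> 0 <= l <= 1 -> Rabs (x + l * u) <= M.
Proof.
intros Hx Hu Hl.
apply Rabs_le_between in Hx; apply Rabs_le_between in Hu; apply Rabs_le; nra.
Qed.

(** Along the segment, the derivative of f(x + l u) - l u f'(x) in l is
    u (f'(x + l u) - f'(x)), of modulus at most c u^2 l; integrate over l. *)
Lemma taylor_order2 (f f1 f2 : R -> R) (c M x u : R) :
  (forall z, is_derive f z (f1 z)) ->
  (forall z, is_derive f1 z (f2 z)) ->
  (forall z, Rabs z <= M -> Rabs (f2 z) <= c) ->
  Rabs x <= M -> Rabs (x + u) <= M ->
  Rabs (f (x + u) - f x - u * f1 x) <= c * u ^ 2 / 2.
Proof.
intros Hf Hf1 Hc Hx Hu.
assert (H : Rabs ((fun l => f (x + l * u) - l * u * f1 x) 1 -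
                  (fun l => f (x + l * u) - l * u * f1 x) 0)
            <= (fun l => c * u ^ 2 * l ^ 2 / 2) 1 - (fun l => c * u ^ 2 * l ^ 2 / 2) 0).
{ apply (increment_abs_bound (fun l => f (x + l * u) - l * u * f1 x)
           (fun l => u * (f1 (x + l * u) - f1 x))
           (fun l => c * u ^ 2 * l ^ 2 / 2) (fun l => c * u ^ 2 * l)); [lra| | |].
  - intros l _; auto_derive.
    + exists (f1 (x + l * u)); apply Hf.
    + rewrite (Derive_eta f _ _ (Hf _)); ring.
  - intros l _; auto_derive; auto; field.
  - intros l Hl; rewrite Rabs_mult.
    assert (HL := lipschitz_on_ball f1 f2 c M Hf1 Hc (x + l * u) x
                    (Rabs_segment M x u l Hx Hu Hl) Hx).
    replace (x + l * u - x) with (l * u) in HL by ring.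
    rewrite Rabs_mult, (Rabs_pos_eq l) in HL by lra.
    rewrite <- (pow2_abs u).
    apply Rle_trans with (Rabs u * (c * (l * Rabs u))).
    + apply Rmult_le_compat_l; [apply Rabs_pos | exact HL].
    + right; ring. }
simpl in H.
replace (f (x + u) - f x - u * f1 x)
  with (f (x + 1 * u) - 1 * u * f1 x - (f (x + 0 * u) - 0 * u * f1 x)).
- replace (c * u ^ 2 / 2) with
    (c * (u * (u * 1)) * (1 * (1 * 1)) / 2 - c * (u * (u * 1)) * (0 * (0 * 1)) / 2)
    by field; exact H.
- rewrite Rmult_1_l, !Rmult_0_l, Rplus_0_r; ring.
Qed.

(** Along the segment, the derivative of the remainder at x + l u is u times
    the second order remainder of f', so that [taylor_order2] applies to f'. *)
Lemma taylor_order3 (f f1 f2 f3 : R -> R) (c M x u : R) :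
  (forall z, is_derive f z (f1 z)) ->
  (forall z, is_derive f1 z (f2 z)) ->
  (forall z, is_derive f2 z (f3 z)) ->
  (forall z, Rabs z <= M -> Rabs (f3 z) <= c) ->
  Rabs x <= M -> Rabs (x + u) <= M ->
  Rabs (f (x + u) - f x - u * f1 x - u ^ 2 / 2 * f2 x) <= c * Rabs u ^ 3 / 6.
Proof.
intros Hf Hf1 Hf2 Hc Hx Hu.
assert (H : Rabs ((fun l => f (x + l * u) - l * u * f1 x - (l * u) ^ 2 / 2 * f2 x) 1 -
                  (fun l => f (x + l * u) - l * u * f1 x - (l * u) ^ 2 / 2 * f2 x) 0)
            <= (fun l => c * Rabs u ^ 3 * l ^ 3 / 6) 1 -
               (fun l => c * Rabs u ^ 3 * l ^ 3 / 6) 0).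
{ apply (increment_abs_bound
           (fun l => f (x + l * u) - l * u * f1 x - (l * u) ^ 2 / 2 * f2 x)
           (fun l => u * (f1 (x + l * u) - f1 x - l * u * f2 x))
           (fun l => c * Rabs u ^ 3 * l ^ 3 / 6)
           (fun l => c * Rabs u ^ 3 * l ^ 2 / 2)); [lra| | |].
  - intros l _; auto_derive.
    + exists (f1 (x + l * u)); apply Hf.
    + rewrite (Derive_eta f _ _ (Hf _)); field.
  - intros l _; auto_derive; auto; field.
  - intros l Hl; rewrite Rabs_mult.
    assert (HT := taylor_order2 f1 f2 f3 c M x (l * u) Hf1 Hf2 Hc Hx
                    (Rabs_segment M x u l Hx Hu Hl)).
    apply Rle_trans with (Rabs u * (c * (l * u) ^ 2 / 2)).
    + apply Rmult_le_compat_l; [apply Rabs_pos | exact HT].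
    + right; rewrite <- (pow2_abs (l * u)), Rabs_mult, (Rabs_pos_eq l) by lra; field. }
cbv beta in H.
replace (f (x + u) - f x - u * f1 x - u ^ 2 / 2 * f2 x)
  with (f (x + 1 * u) - 1 * u * f1 x - (1 * u) ^ 2 / 2 * f2 x -
       (f (x + 0 * u) - 0 * u * f1 x - (0 * u) ^ 2 / 2 * f2 x)).
- replace (c * Rabs u ^ 3 / 6) with
    (c * Rabs u ^ 3 * 1 ^ 3 / 6 - c * Rabs u ^ 3 * 0 ^ 3 / 6) by field; exact H.
- rewrite Rmult_1_l, !Rmult_0_l, Rplus_0_r; field.
Qed.

(** The square of the difference satisfies w' <= 2 L w, so that w exp(-2 L t)
    does not increase. *)
Lemma gronwall (x y dx dy : R -> R) (L p q : R) :
  p <= q ->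
  (forall t, p <= t <= q -> is_derive x t (dx t)) ->
  (forall t, p <= t <= q -> is_derive y t (dy t)) ->
  (forall t, p <= t <= q -> Rabs (dx t - dy t) <= L * Rabs (x t - y t)) ->
  Rabs (x q - y q) <= Rabs (x p - y p) * exp (L * (q - p)).
Proof.
intros Hpq Hx Hy HL.
set (W := fun t => (x t - y t) ^ 2 * exp (- (2 * L * (t - p)))).
assert (H : W q - W p <= (fun _ => 0) q - (fun _ => 0) p).
{ apply (increment_bound W
    (fun t => (2 * (x t - y t) * (dx t - dy t) - 2 * L * (x t - y t) ^ 2)
              * exp (- (2 * L * (t - p)))) (fun _ => 0) (fun _ => 0)); auto.
  - intros t Ht; unfold W; auto_derive.
    + split; [exists (dx t); apply Hx; auto|].
      split; [exists (dy t); apply Hy; auto| auto].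
      rewrite (Derive_eta x _ _ (Hx t Ht)).
      rewrite (Derive_eta y _ _ (Hy t Ht)).
      unfold Rminus; ring.
  - intros t _; auto_derive; auto.
  - intros t Ht; specialize (HL t Ht).
    assert (He := exp_pos (- (2 * L * (t - p)))).
    assert ((x t - y t) * (dx t - dy t) <= L * (x t - y t) ^ 2).
    { eapply Rle_trans; [apply Rle_abs|].
      rewrite Rabs_mult, <- (pow2_abs (x t - y t)).
      replace (L * Rabs (x t - y t) ^ 2)
        with (Rabs (x t - y t) * (L * Rabs (x t - y t))) by ring.
      apply Rmult_le_compat_l; [apply Rabs_pos | exact HL]. }
    nra. }
unfold W in H.
replace (- (2 * L * (p - p))) with 0 in H by ring.
rewrite exp_0 in H.
apply Rsqr_incr_0_var; [| apply Rmult_le_pos; [apply Rabs_pos | left; apply exp_pos]].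
rewrite Rsqr_mult, <- !Rsqr_abs; unfold Rsqr.
assert (E : exp (L * (q - p)) * exp (L * (q - p)) * exp (- (2 * L * (q - p))) = 1).
{ rewrite <- !exp_plus, <- exp_0; f_equal; ring. }
assert (E1 := exp_pos (L * (q - p))).
set (e := exp (L * (q - p))) in *; set (i := exp (- (2 * L * (q - p)))) in *.
assert (He2 : 0 < e * e) by nra.
assert ((x q - y q) ^ 2 * i <= (x p - y p) ^ 2) by lra.
assert ((x q - y q) ^ 2 * i * (e * e) <= (x p - y p) ^ 2 * (e * e))
  by (apply Rmult_le_compat_r; lra).
replace ((x q - y q) ^ 2 * i * (e * e)) with ((x q - y q) ^ 2 * (e * e * i)) in H1 by ring.
rewrite E in H1; nra.
Qed.

(** * Global existence for bounded, globally Lipschitz equations *)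

Lemma is_lim_seq_geometric (A : R) : is_lim_seq (fun n => A * (1 / 2) ^ n) 0.
Proof.
replace (Finite 0) with (Rbar_mult A 0) by (simpl; f_equal; ring).
apply is_lim_seq_scal_l, is_lim_seq_geom.
rewrite Rabs_pos_eq; lra.
Qed.

Lemma is_lim_seq_dist (u v : nat -> R) (l : R) :
  (forall n, Rabs (u n - l) <= v n) -> is_lim_seq v 0 -> is_lim_seq u l.
Proof.
intros Hu Hv.
apply is_lim_seq_le_le with (fun n => l - v n) (fun n => l + v n).
- intros n; specialize (Hu n); apply Rabs_le_between in Hu; lra.
- replace (Finite l) with (Finite (l - 0)) by (f_equal; ring).
  apply is_lim_seq_minus' with (1 := is_lim_seq_const l) (2 := Hv).
- replace (Finite l) with (Finite (l + 0)) by (f_equal; ring).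
  apply is_lim_seq_plus' with (1 := is_lim_seq_const l) (2 := Hv).
Qed.

Lemma is_lim_seq_Rabs_le (u : nat -> R) (l c M : R) :
  is_lim_seq u l -> (forall n, Rabs (u n - c) <= M) -> Rabs (l - c) <= M.
Proof.
intros Hu HM.
apply (is_lim_seq_le (fun n => Rabs (u n - c)) (fun _ => M) (Rabs (l - c)) M HM).
- apply (is_lim_seq_abs _ (l - c)).
  apply is_lim_seq_minus' with (1 := Hu) (2 := is_lim_seq_const c).
- apply is_lim_seq_const.
Qed.

Lemma geometric_tail (u : nat -> R) (A : R) :
  (forall n, Rabs (u (S n) - u n) <= A * (1 / 2) ^ n) ->
  is_lim_seq u (real (Lim_seq u)) /\
  forall n, Rabs (real (Lim_seq u) - u n) <= 2 * A * (1 / 2) ^ n.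
Proof.
intros Hu.
assert (HA : 0 <= A).
{ specialize (Hu 0%nat); simpl in Hu; generalize (Rabs_pos (u 1%nat - u 0%nat)); lra. }
assert (Hk : forall n k, Rabs (u (n + k)%nat - u n)
                <= 2 * A * (1 / 2) ^ n * (1 - (1 / 2) ^ k)).
{ intros n k; induction k as [|k IH].
  - rewrite Nat.add_0_r, Rminus_diag, Rabs_R0; simpl; lra.
  - rewrite Nat.add_succ_r.
    replace (u (S (n + k)) - u n)
      with ((u (S (n + k)) - u (n + k)%nat) + (u (n + k)%nat - u n)) by ring.
    eapply Rle_trans; [apply Rabs_triang|].
    specialize (Hu (n + k)%nat); rewrite pow_add in Hu.
    simpl pow; nra. }
assert (Hp : forall k, 0 < (1 / 2) ^ k) by (intros k; apply pow_lt; lra).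
assert (Hb : forall n k, Rabs (u (n + k)%nat - u n) <= 2 * A * (1 / 2) ^ n).
{ intros n k; eapply Rle_trans; [apply Hk|].
  generalize (Hp k) (Hp n); intros.
  assert (0 <= 2 * A * (1 / 2) ^ n) by nra.
  nra. }
assert (Hl : ex_finite_lim_seq u).
{ apply ex_lim_seq_cauchy_corr; intros e.
  destruct (proj2 (is_lim_seq_spec _ _) (is_lim_seq_geometric (4 * A)) e) as [N HN].
  exists N; intros n m Hn Hm.
  specialize (HN N (Nat.le_refl N)).
  rewrite Rminus_0_r in HN.
  eapply Rle_lt_trans; [|eapply Rle_lt_trans; [apply Rle_abs | apply HN]].
  assert (H1 := Hb N (n - N)%nat); assert (H2 := Hb N (m - N)%nat).
  replace (N + (n - N))%nat with n in H1 by lia.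
  replace (N + (m - N))%nat with m in H2 by lia.
  replace (u n - u m) with ((u n - u N) + - (u m - u N)) by ring.
  eapply Rle_trans; [apply Rabs_triang|].
  rewrite Rabs_Ropp; lra. }
assert (HL := Lim_seq_correct' u Hl).
split; [exact HL|].
intros n.
apply (is_lim_seq_Rabs_le (fun k => u (n + k)%nat)); auto.
apply is_lim_seq_ext with (fun k => u (k + n)%nat).
- intros k; f_equal; lia.
- apply (is_lim_seq_incr_n u n (Finite (Lim_seq u))), HL.
Qed.

Lemma continuous_of_lipschitz (f : R -> R) (M : R) :
  (forall s t, Rabs (f s - f t) <= M * Rabs (s - t)) -> forall t, continuous f t.
Proof.
intros HM t.
assert (M0 : 0 <= M).
{ specialize (HM 1 0); rewrite Rminus_0_r, Rabs_R1 in HM.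
  generalize (Rabs_pos (f 1 - f 0)); lra. }
apply filterlim_locally; intros e.
assert (He : 0 < e / (M + 1)) by (apply Rdiv_lt_0_compat; [apply cond_pos | lra]).
exists (mkposreal _ He); intros s Hs.
change (Rabs (s - t) < e / (M + 1)) in Hs.
change (Rabs (f s - f t) < e).
apply Rle_lt_trans with ((M + 1) * Rabs (s - t)).
- eapply Rle_trans; [apply HM|].
  generalize (Rabs_pos (s - t)); nra.
- apply Rlt_le_trans with ((M + 1) * (e / (M + 1))).
  + apply Rmult_lt_compat_l; lra.
  + right; field; lra.
Qed.

Lemma is_derive_primitive (f : R -> R) (c t0 t : R) :
  (forall s, continuous f s) -> is_derive (fun t => c + RInt f t0 t) t (f t).
Proof.
intros Hf.
replace (f t) with (0 + f t) by ring.
apply (is_derive_plus (fun _ => c) (fun t => RInt f t0 t)).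
- apply @is_derive_const.
- apply (is_derive_RInt f _ t0); [|apply Hf].
  exists (mkposreal 1 Rlt_0_1); intros s _.
  apply (RInt_correct (V:=R_CompleteNormedModule)).
  apply (ex_RInt_continuous (V:=R_CompleteNormedModule)); auto.
Qed.

Fixpoint picard_iterate (g : R -> R -> R) (t0 x0 : R) (n : nat) (t : R) : R :=
  match n with
  | O => x0
  | S n => x0 + RInt (fun s => g s (picard_iterate g t0 x0 n s)) t0 t
  end.

(** Picard iteration converges on the whole ray t0 <= t at once when distances
    are weighted by exp(2 L (t - t0)): with this weight the integral operator
    is a contraction of ratio 1/2. The bound M on g makes all iterates, hence
    their limit, M-Lipschitz, so the limit can be integrated. The solution is
    differentiable from both sides at t0 because it is defined as a primitive
    on the whole line. *)
Lemma picard_lindelof (g : R -> R -> R) (M L t0 x0 : R) :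
  0 < L ->
  (forall t x, Rabs (g t x) <= M) ->
  (forall t x y, Rabs (g t x - g t y) <= L * Rabs (x - y)) ->
  (forall x, (forall t, continuous x t) ->
             forall t, continuous (fun s => g s (x s)) t) ->
  exists X : R -> R,
    X t0 = x0 /\ forall t, t0 <= t -> is_derive X t (g t (X t)).
Proof.
intros L0 HM HL Hc.
set (u := picard_iterate g t0 x0).
assert (M0 : 0 <= M) by (generalize (HM 0 0) (Rabs_pos (g 0 0)); lra).
assert (Hcu : forall n t, continuous (u n) t).
{ induction n as [|n IH]; intros t.
  - apply continuous_const.
  - apply (ex_derive_continuous (u (S n))).
    exists (g t (u n t)).
    apply (is_derive_primitive (fun s => g s (u n s))); intros s; apply Hc, IH. }
assert (Hdu : forall n t, is_derive (u (S n)) t (g t (u n t))).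
{ intros n t; apply (is_derive_primitive (fun s => g s (u n s))); intros s; apply Hc, Hcu. }
assert (Hu0 : forall n, u n t0 = x0).
{ intros [|n]; [reflexivity|]; unfold u; simpl; rewrite RInt_point; apply Rplus_0_r. }
(* E bounds the first correction, as M <= E', and satisfies L E = E' / 2,
   which gains a factor 1/2 at each iteration *)
set (E := fun t => M / (2 * L) * exp (2 * L * (t - t0))).
assert (HE : forall c t, is_derive (fun t => c * E t) t (c * (2 * L * E t))).
{ intros c t; unfold E; auto_derive; auto; unfold Rminus; field; lra. }
assert (HEM : forall t, t0 <= t -> M <= 2 * L * E t).
{ intros t Ht; unfold E.
  replace (2 * L * (M / (2 * L) * exp (2 * L * (t - t0))))
    with (M * exp (2 * L * (t - t0))) by (field; lra).
  assert (1 <= exp (2 * L * (t - t0))).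
  { generalize (exp_ineq1_le (2 * L * (t - t0))); nra. }
  nra. }
assert (HE0 : forall t, 0 <= E t).
{ intros t; unfold E; apply Rmult_le_pos; [|left; apply exp_pos].
  apply Rdiv_le_0_compat; lra. }
assert (Hp : forall k, 0 < (1 / 2) ^ k) by (intros k; apply pow_lt; lra).
assert (Hstep : forall n t, t0 <= t -> Rabs (u (S n) t - u n t) <= E t * (1 / 2) ^ n).
{ induction n as [|n IH]; intros t Ht.
  - assert (H := increment_abs_bound (u 1%nat) (fun t => g t (u 0%nat t))
       (fun t => 1 * E t) (fun t => 1 * (2 * L * E t)) t0 t Ht
       (fun s _ => Hdu 0%nat s) (fun s _ => HE 1 s)).
    rewrite Hu0 in H; simpl (u 0%nat _); simpl pow.
    assert (H1 : Rabs (u 1%nat t - x0) <= 1 * E t - 1 * E t0).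
    { apply H; intros s Hs; eapply Rle_trans; [apply HM|].
      specialize (HEM s (proj1 Hs)); lra. }
    generalize (HE0 t0); unfold u in *; simpl in *; lra.
  - assert (H := increment_abs_bound (fun t => u (S (S n)) t - u (S n) t)
       (fun t => g t (u (S n) t) - g t (u n t))
       (fun t => (1 / 2) ^ S n * E t) (fun t => (1 / 2) ^ S n * (2 * L * E t)) t0 t Ht).
    cbv beta in H; rewrite (Hu0 (S (S n))), (Hu0 (S n)) in H.
    rewrite Rminus_diag, Rminus_0_r in H.
    apply Rle_trans with ((1 / 2) ^ S n * E t - (1 / 2) ^ S n * E t0).
    + apply H.
      * intros s _; apply (is_derive_minus (u (S (S n))) (u (S n))); apply Hdu.
      * intros s _; apply HE.
      * intros s Hs; eapply Rle_trans; [apply HL|].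
        specialize (IH s (proj1 Hs)).
        apply Rle_trans with (L * (E s * (1 / 2) ^ n)).
        -- apply Rmult_le_compat_l; lra.
        -- right; simpl; field.
    + generalize (HE0 t0) (Hp (S n)); nra. }
set (X := fun t => real (Lim_seq (fun n => u n (Rmax t0 t)))).
assert (HX : forall t, is_lim_seq (fun n => u n (Rmax t0 t)) (X t)).
{ intros t; apply (geometric_tail _ (E (Rmax t0 t))).
  intros n; apply Hstep, Rmax_l. }
assert (HXu : forall n t, t0 <= t -> Rabs (X t - u n t) <= 2 * E t * (1 / 2) ^ n).
{ intros n t Ht; unfold X; rewrite Rmax_right by exact Ht.
  apply (geometric_tail (fun n => u n t)); intros m; apply Hstep, Ht. }
assert (Hmax : forall s t, Rabs (Rmax t0 s - Rmax t0 t) <= Rabs (s - t)).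
{ intros s t; unfold Rmax; destruct (Rle_dec t0 s), (Rle_dec t0 t);
    unfold Rabs; repeat destruct Rcase_abs; lra. }
assert (HXc : forall t, continuous X t).
{ apply (continuous_of_lipschitz X M); intros s t.
  assert (W : forall n s t, Rabs (u n s - u n t) <= M * Rabs (s - t)).
  { intros n s' t'; destruct n as [|n].
    - simpl; rewrite Rminus_diag, Rabs_R0.
      generalize (Rabs_pos (s' - t')); nra.
    - apply (lipschitz_on_ball (u (S n)) (fun t => g t (u n t)) M (Rmax (Rabs s') (Rabs t'))); auto.
      + apply Rmax_l.
      + apply Rmax_r. }
  assert (H : is_lim_seq (fun n => u n (Rmax t0 s) - u n (Rmax t0 t)) (X s - X t))
    by (apply is_lim_seq_minus' with (1 := HX s) (2 := HX t)).
  rewrite <- (Rminus_0_r (X s - X t)).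
  apply (is_lim_seq_Rabs_le _ _ _ _ H); intros n.
  rewrite Rminus_0_r; eapply Rle_trans; [apply W|].
  apply Rmult_le_compat_l; [exact M0 | apply Hmax]. }
(* X is extended by its value at t0 to the left of t0; Y solves the integral
   equation on the whole line and agrees with X for t0 <= t *)
set (Y := fun t => x0 + RInt (fun s => g s (X s)) t0 t).
assert (HY : forall t, is_derive Y t (g t (X t))).
{ intros t; apply (is_derive_primitive (fun s => g s (X s))), Hc, HXc. }
assert (HYX : forall t, t0 <= t -> Y t = X t).
{ intros t Ht.
  assert (H1 : is_lim_seq (fun n => u (S n) t) (Y t)).
  { apply is_lim_seq_dist with (2 := is_lim_seq_geometric (E t)); intros n.
    rewrite Rabs_minus_sym.
    assert (H := increment_abs_bound (fun t => Y t - u (S n) t)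
       (fun t => g t (X t) - g t (u n t))
       (fun t => (1 / 2) ^ n * E t) (fun t => (1 / 2) ^ n * (2 * L * E t)) t0 t Ht).
    assert (HY0 : Y t0 = x0) by (unfold Y; rewrite RInt_point; apply Rplus_0_r).
    cbv beta in H; rewrite (Hu0 (S n)), HY0, Rminus_diag, Rminus_0_r in H.
    apply Rle_trans with ((1 / 2) ^ n * E t - (1 / 2) ^ n * E t0).
    + apply H.
      * intros s _; apply (is_derive_minus Y (u (S n))); [apply HY | apply Hdu].
      * intros s _; apply HE.
      * intros s Hs; eapply Rle_trans; [apply HL|].
        specialize (HXu n s (proj1 Hs)).
        apply Rle_trans with (L * (2 * E s * (1 / 2) ^ n)).
        -- apply Rmult_le_compat_l; lra.
        -- right; ring.
    + generalize (HE0 t0) (Hp n); nra. }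
  assert (H2 := HX t); rewrite Rmax_right in H2 by exact Ht.
  apply is_lim_seq_incr_1 in H2.
  apply is_lim_seq_unique in H1; apply is_lim_seq_unique in H2.
  rewrite H1 in H2; injection H2; auto. }
exists Y; split.
- unfold Y; rewrite RInt_point; apply Rplus_0_r.
- intros t Ht; rewrite (HYX t Ht); apply HY.
Qed.

(** * Uniqueness, order, and convergence of bounded solutions *)

Definition oscillating_field (eps a : R) (h : R -> R) (t x : R) : R :=
  - eps * sin t * h (x + a * sin t).

Definition solves (v : R -> R -> R) (D : R -> Prop) (x : R -> R) : Prop :=
  forall t, D t -> is_derive x t (v t (x t)).

(** A one-sided derivative at the initial time becomes two-sided when the
    function is continued to the left by its tangent line. This lets calculus
    be done with ordinary derivatives on closed intervals. The second
    hypothesis says that D is relatively open in the ray t0 <= t. *)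
Lemma two_sided_extension (x f : R -> R) (D : R -> Prop) (t0 : R) :
  (forall t, D t -> t0 <= t) ->
  (forall t, D t -> exists d, 0 < d /\ forall s, t0 <= s -> Rabs (s - t) < d -> D s) ->
  (forall t, D t -> D_in x f D t) ->
  exists X : R -> R,
    (forall t, t0 <= t -> X t = x t) /\ forall t, D t -> is_derive X t (f t).
Proof.
intros HD Hop Hx.
set (X := fun t => if Rle_dec t0 t then x t else x t0 + (t - t0) * f t0).
assert (HX : forall t, t0 <= t -> X t = x t).
{ intros t Ht; unfold X; destruct (Rle_dec t0 t); [reflexivity | lra]. }
exists X; split; [exact HX|].
intros t Ht; apply is_derive_Reals; intros e He.
destruct (Hop t Ht) as [d1 [Hd1 Hop1]].
destruct (Hx t Ht e He) as [d2 [Hd2 Hlim]].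
assert (Hd3 : exists d3, 0 < d3 /\ (t0 < t -> d3 <= t - t0)).
{ destruct (Rlt_dec t0 t) as [H|H].
  - exists (t - t0); split; intros; lra.
  - exists 1; split; intros; lra. }
destruct Hd3 as [d3 [Hd3 Hd3']].
assert (Hd : 0 < Rmin d1 (Rmin d2 d3)) by (repeat apply Rmin_glb_lt; auto).
exists (mkposreal _ Hd); intros k Hk Hkd; simpl in Hkd.
assert (Hkd1 : Rabs k < d1) by (eapply Rlt_le_trans; [exact Hkd | apply Rmin_l]).
assert (Hkd2 : Rabs k < d2).
{ eapply Rlt_le_trans; [exact Hkd|]; eapply Rle_trans; [apply Rmin_r | apply Rmin_l]. }
assert (Hkd3 : Rabs k < d3).
{ eapply Rlt_le_trans; [exact Hkd|]; eapply Rle_trans; [apply Rmin_r | apply Rmin_r]. }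
specialize (HD t Ht).
destruct (Rle_dec t0 (t + k)) as [Hle|Hgt].
- rewrite (HX _ Hle), (HX _ HD).
  assert (H := Hlim (t + k)); simpl in H; unfold Rdist, D_x in H.
  replace (t + k - t) with k in H by ring.
  apply H; repeat split; auto; try lra.
  apply Hop1; auto; replace (t + k - t) with k by ring; auto.
- assert (Et : t0 = t).
  { destruct (Rle_lt_or_eq_dec t0 t HD) as [Hlt|]; auto.
    specialize (Hd3' Hlt); apply Rabs_def2 in Hkd3; lra. }
  rewrite (HX _ HD); unfold X; destruct (Rle_dec t0 (t + k)); [contradiction|].
  subst t0.
  replace ((x t + (t + k - t) * f t - x t) / k - f t) with 0 by (field; auto).
  rewrite Rabs_R0; exact He.
Qed.

Lemma D_in_of_is_derive (x f : R -> R) (D : R -> Prop) (t : R) :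
  is_derive x t (f t) -> D_in x f D t.
Proof.
intros Hd e He.
apply is_derive_Reals in Hd.
destruct (Hd e He) as [d Hd'].
exists d; split; [apply cond_pos|].
intros s [[Hs Hst] Hsd]; simpl in *; unfold Rdist in *.
assert (H := Hd' (s - t)).
replace (t + (s - t)) with s in H by ring.
apply H; auto; lra.
Qed.

Lemma two_sided_ray (eps a : R) (h x : R -> R) (t0 : R) :
  is_solution eps a h (fun t => t0 <= t) x ->
  exists X : R -> R,
    (forall t, t0 <= t -> X t = x t) /\
    solves (oscillating_field eps a h) (fun t => t0 <= t) X.
Proof.
intros Hx.
destruct (two_sided_extension x (fun s => - eps * sin s * h (x s + a * sin s))
            (fun t => t0 <= t) t0) as [X [HX Hd]]; auto.
- intros t Ht; exists 1; split; auto; lra.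
- exists X; split; auto.
  intros t Ht; unfold oscillating_field; rewrite HX by exact Ht; auto.
Qed.

Lemma two_sided_interval (eps a : R) (h x : R -> R) (t0 T : R) :
  is_solution eps a h (fun t => t0 <= t < T) x ->
  exists X : R -> R,
    (forall t, t0 <= t -> X t = x t) /\
    solves (oscillating_field eps a h) (fun t => t0 <= t < T) X.
Proof.
intros Hx.
destruct (two_sided_extension x (fun s => - eps * sin s * h (x s + a * sin s))
            (fun t => t0 <= t < T) t0) as [X [HX Hd]]; auto.
- intros t Ht; lra.
- intros t Ht; exists (T - t); split; [lra|].
  intros s Hs Hst; apply Rabs_def2 in Hst; lra.
- exists X; split; auto.
  intros t Ht; unfold oscillating_field; rewrite HX by apply Ht; auto.
Qed.

Lemma is_solution_of_solves (eps a : R) (h x : R -> R) (D : R -> Prop) :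
  solves (oscillating_field eps a h) D x -> is_solution eps a h D x.
Proof.
intros Hx t Ht.
exact (D_in_of_is_derive x (fun s => - eps * sin s * h (x s + a * sin s)) D t (Hx t Ht)).
Qed.

Lemma bounded_on_segment (x : R -> R) (p q : R) :
  p <= q -> (forall t, p <= t <= q -> continuous x t) ->
  exists M, forall t, p <= t <= q -> Rabs (x t) <= M.
Proof.
intros Hpq Hc.
destruct (continuity_ab_maj (fun t => Rabs (x t)) p q Hpq) as [m [Hm _]].
- intros t Ht; apply continuity_pt_filterlim.
  apply (continuous_comp x Rabs); [auto | apply continuous_Rabs].
- exists (Rabs (x m)); exact Hm.
Qed.

Lemma bounded_on_ball (f : R -> R) (M : R) :
  (forall z, continuous f z) ->
  exists L, 0 < L /\ forall z, Rabs z <= M -> Rabs (f z) <= L.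
Proof.
intros Hf; destruct (Rle_dec 0 M) as [HM|HM].
- destruct (bounded_on_segment f (- M) M) as [L HL]; [lra | auto |].
  exists (Rmax L 1); split.
  + apply Rlt_le_trans with (2 := Rmax_r L 1); lra.
  + intros z Hz; eapply Rle_trans; [apply HL, Rabs_le_between, Hz | apply Rmax_l].
- exists 1; split; [lra|]; intros z Hz; generalize (Rabs_pos z); lra.
Qed.

Lemma Rabs_sin_le_1 (t : R) : Rabs (sin t) <= 1.
Proof. apply Rabs_le, SIN_bound. Qed.

Lemma oscillating_field_lipschitz (eps a : R) (h : R -> R) (L t x y : R) :
  0 < eps -> 0 <= L ->
  Rabs (h (x + a * sin t) - h (y + a * sin t)) <= L * Rabs (x - y) ->
  Rabs (oscillating_field eps a h t x - oscillating_field eps a h t y) <= eps * L * Rabs (x - y).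
Proof.
intros He HL H; unfold oscillating_field.
replace (- eps * sin t * h (x + a * sin t) - - eps * sin t * h (y + a * sin t))
  with (- (eps * (sin t * (h (x + a * sin t) - h (y + a * sin t))))) by ring.
rewrite Rabs_Ropp, !Rabs_mult, (Rabs_pos_eq eps), Rmult_assoc by lra.
apply Rmult_le_compat_l; [lra|].
generalize (Rabs_sin_le_1 t) (Rabs_pos (sin t))
  (Rabs_pos (h (x + a * sin t) - h (y + a * sin t))); nra.
Qed.

Lemma Rabs_shift_le (a x M t : R) :
  0 < a -> Rabs x <= M -> Rabs (x + a * sin t) <= M + a.
Proof.
intros Ha Hx; eapply Rle_trans; [apply Rabs_triang|].
rewrite Rabs_mult, (Rabs_pos_eq a) by lra.
generalize (Rabs_sin_le_1 t); nra.
Qed.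

(** Both solutions are bounded on the segment, so that a Lipschitz constant of
    h on a ball is enough to apply Gronwall. *)
Lemma solution_unique (eps a : R) (h h1 x y : R -> R) (p q : R) :
  0 < eps -> 0 < a ->
  (forall z, is_derive h z (h1 z)) -> (forall z, continuous h1 z) ->
  p <= q ->
  solves (oscillating_field eps a h) (fun t => p <= t <= q) x ->
  solves (oscillating_field eps a h) (fun t => p <= t <= q) y ->
  x p = y p -> x q = y q.
Proof.
intros He Ha Hh Hc Hpq Hx Hy Hxy.
destruct (bounded_on_segment x p q Hpq) as [Mx HMx].
{ intros t Ht; apply (ex_derive_continuous x); eexists; apply (Hx t Ht). }
destruct (bounded_on_segment y p q Hpq) as [My HMy].
{ intros t Ht; apply (ex_derive_continuous y); eexists; apply (Hy t Ht). }
destruct (bounded_on_ball h1 (Rmax Mx My + a) Hc) as [L [HL0 HL]].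
assert (H := gronwall x y _ _ (eps * L) p q Hpq Hx Hy).
rewrite Hxy, Rminus_diag, Rabs_R0, Rmult_0_l in H.
assert (H1 : Rabs (x q - y q) <= 0).
{ apply H; intros t Ht.
  apply oscillating_field_lipschitz; [exact He | lra |].
  replace (x t - y t) with ((x t + a * sin t) - (y t + a * sin t)) by ring.
  apply (lipschitz_on_ball h h1 L (Rmax Mx My + a) Hh HL); apply Rabs_shift_le; auto.
  - eapply Rle_trans; [apply HMx, Ht | apply Rmax_l].
  - eapply Rle_trans; [apply HMy, Ht | apply Rmax_r]. }
generalize (Rabs_pos (x q - y q)); intros.
destruct (Req_dec (x q - y q) 0) as [E|E]; [lra|].
apply Rabs_pos_lt in E; lra.
Qed.

Lemma crossing (x y : R -> R) (p q : R) :
  p <= q ->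
  (forall t, p <= t <= q -> continuous x t) ->
  (forall t, p <= t <= q -> continuous y t) ->
  x p <= y p -> y q < x q -> exists s, p <= s <= q /\ x s = y s.
Proof.
intros Hpq Hx Hy H1 H2.
destruct (Req_dec (x p) (y p)) as [E|E]; [exists p; split; [lra | exact E]|].
destruct (Req_dec p q) as [E'|E']; [subst; lra|].
destruct (IVT_interv (fun t => x t - y t) p q) as [s [Hs Es]]; try lra.
- intros t Ht; apply continuity_pt_filterlim.
  apply (continuous_minus x y); auto.
- exists s; split; [exact Hs | lra].
Qed.

(** Solutions of a scalar equation cannot cross: from a crossing on they would
    coincide. *)
Lemma solution_order (eps a : R) (h h1 x y : R -> R) (p q : R) :
  0 < eps -> 0 < a ->
  (forall z, is_derive h z (h1 z)) -> (forall z, continuous h1 z) ->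
  p <= q ->
  solves (oscillating_field eps a h) (fun t => p <= t <= q) x ->
  solves (oscillating_field eps a h) (fun t => p <= t <= q) y ->
  x p <= y p -> x q <= y q.
Proof.
intros He Ha Hh Hc Hpq Hx Hy Hxy.
destruct (Rle_dec (x q) (y q)) as [|H]; auto.
destruct (crossing x y p q) as [s [Hs Es]]; auto; try lra.
- intros t Ht; apply (ex_derive_continuous x); eexists; apply (Hx t Ht).
- intros t Ht; apply (ex_derive_continuous y); eexists; apply (Hy t Ht).
- right; apply (solution_unique eps a h h1 x y s q); auto; try lra.
  + intros t Ht; apply Hx; lra.
  + intros t Ht; apply Hy; lra.
Qed.

(** The projection onto [-M, M]. Composing h with it makes the equation
    globally Lipschitz without changing solutions that remain small. *)
Definition clip (M z : R) : R := Rmax (- M) (Rmin M z).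

Lemma clip_id (M z : R) : Rabs z <= M -> clip M z = z.
Proof.
intros H; apply Rabs_le_between in H; unfold clip.
rewrite Rmin_right, Rmax_right by lra; reflexivity.
Qed.

Lemma Rabs_clip_le (M z : R) : 0 <= M -> Rabs (clip M z) <= M.
Proof.
intros HM; apply Rabs_le; unfold clip, Rmax, Rmin.
destruct (Rle_dec M z); destruct (Rle_dec (- M) _); lra.
Qed.

Lemma clip_lipschitz (M y z : R) : Rabs (clip M y - clip M z) <= Rabs (y - z).
Proof.
unfold clip, Rmax, Rmin.
destruct (Rle_dec M y); destruct (Rle_dec M z); repeat destruct (Rle_dec (- M) _);
  unfold Rabs; repeat destruct Rcase_abs; lra.
Qed.

Lemma clipped_lipschitz (h h1 : R -> R) (M : R) :
  0 <= M ->
  (forall z, is_derive h z (h1 z)) -> (forall z, continuous h1 z) ->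
  exists L, 0 < L /\ forall y z, Rabs (h (clip M y) - h (clip M z)) <= L * Rabs (y - z).
Proof.
intros HM Hh Hc.
destruct (bounded_on_ball h1 M Hc) as [L [HL0 HL]].
exists L; split; [exact HL0|]; intros y z.
eapply Rle_trans.
- apply (lipschitz_on_ball h h1 L M Hh HL); apply Rabs_clip_le, HM.
- apply Rmult_le_compat_l; [lra | apply clip_lipschitz].
Qed.

Lemma clipped_solution (eps a : R) (h h1 : R -> R) (M t0 x0 : R) :
  0 < eps -> 0 <= M ->
  (forall z, is_derive h z (h1 z)) -> (forall z, continuous h1 z) ->
  exists X, X t0 = x0 /\
    solves (oscillating_field eps a (fun z => h (clip M z))) (fun t => t0 <= t) X.
Proof.
intros He HM Hh Hc.
destruct (clipped_lipschitz h h1 M HM Hh Hc) as [L [HL0 HL]].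
destruct (bounded_on_ball h M) as [B [HB0 HB]].
{ intros z; apply (ex_derive_continuous h); exists (h1 z); apply Hh. }
apply (picard_lindelof (oscillating_field eps a (fun z => h (clip M z))) (eps * B) (eps * L)).
- nra.
- intros t x; unfold oscillating_field; rewrite !Rabs_mult, Rabs_Ropp, (Rabs_pos_eq eps) by lra.
  rewrite Rmult_assoc; apply Rmult_le_compat_l; [lra|].
  specialize (HB (clip M (x + a * sin t)) (Rabs_clip_le _ _ HM)).
  generalize (Rabs_sin_le_1 t) (Rabs_pos (sin t)) (Rabs_pos (h (clip M (x + a * sin t)))).
  nra.
- intros t x y; apply oscillating_field_lipschitz; [exact He | lra |].
  eapply Rle_trans; [apply HL|].
  right; do 2 f_equal; ring.
- intros x Hx t; unfold oscillating_field.
  apply (continuous_mult (fun s => - eps * sin s)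
           (fun s => h (clip M (x s + a * sin s)))).
  + apply (continuous_mult (fun _ => - eps) sin);
      [apply continuous_const | apply continuous_sin].
  + apply (continuous_comp (fun s => x s + a * sin s) (fun z => h (clip M z))).
    * apply (continuous_plus x (fun s => a * sin s)); [apply Hx|].
      apply (continuous_mult (fun _ => a) sin);
        [apply continuous_const | apply continuous_sin].
    * apply (continuous_of_lipschitz _ L), HL.
Qed.

Lemma solves_shift (eps a : R) (h x : R -> R) (t0 : R) (k : nat) :
  solves (oscillating_field eps a h) (fun t => t0 <= t) x ->
  solves (oscillating_field eps a h) (fun t => t0 - 2 * INR k * PI <= t)
    (fun t => x (t + 2 * INR k * PI)).
Proof.
intros Hx t Ht.
assert (H := Hx (t + 2 * INR k * PI)); unfold oscillating_field in *.
rewrite sin_period in H.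
set (v := - eps * sin t * h _) in *.
replace v with (1 * v) by ring.
apply (is_derive_comp x (fun t => t + 2 * INR k * PI)).
- apply H; lra.
- auto_derive; auto; ring.
Qed.

Lemma periodic_multiple (x : R -> R) (k : nat) (t : R) :
  (forall t, 0 <= t -> x (t + 2 * PI) = x t) ->
  0 <= t -> x (t + 2 * INR k * PI) = x t.
Proof.
intros Hx Ht; induction k as [|k IH].
- simpl; f_equal; ring.
- rewrite <- IH, <- (Hx (t + 2 * INR k * PI)).
  + f_equal; rewrite S_INR; ring.
  + generalize (pos_INR k) PI_RGT_0; nra.
Qed.

Lemma multiple_of_period_above (A : R) : exists n, A <= 2 * INR n * PI.
Proof.
destruct (INR_unbounded A) as [n Hn]; exists n.
generalize (pos_INR n) PI2_1; nra.
Qed.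

Lemma period_decomposition (t : R) :
  0 <= t -> exists (k : nat) (s : R), 0 <= s <= 2 * PI /\ t = s + 2 * INR k * PI.
Proof.
intros Ht; assert (HP := PI_RGT_0).
destruct (nfloor_ex (t / (2 * PI))) as [k [H1 H2]].
{ apply Rdiv_le_0_compat; lra. }
exists k, (t - 2 * INR k * PI); split; [|ring].
assert (E : t = t / (2 * PI) * (2 * PI)) by (field; lra).
split; nra.
Qed.

(** After a shift of time by whole periods x becomes a solution y on the
    nonnegative half-line. Its samples at multiples of 2 pi are monotone, since
    y and its translate by 2 pi keep their order; their limit is the initial
    value of X. *)
Lemma bounded_solution_converges (eps a : R) (h h1 x : R -> R) (t0 M : R) :
  0 < eps -> 0 < a ->
  (forall z, is_derive h z (h1 z)) -> (forall z, continuous h1 z) ->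
  solves (oscillating_field eps a h) (fun t => t0 <= t) x ->
  (forall t, t0 <= t -> Rabs (x t) <= M) ->
  exists X : R -> R,
    solves (oscillating_field eps a h) (fun t => 0 <= t) X /\
    (forall t, 0 <= t -> X (t + 2 * PI) = X t) /\
    is_lim (fun t => Rabs (x t - X t)) p_infty 0.
Proof.
intros He Ha Hh Hc Hx HM.
assert (HP := PI_RGT_0).
assert (HM0 : 0 <= M) by (generalize (HM t0 (Rle_refl t0)) (Rabs_pos (x t0)); lra).
destruct (multiple_of_period_above t0) as [N HN].
set (y := fun t => x (t + 2 * INR N * PI)).
assert (Hy : solves (oscillating_field eps a h) (fun t => 0 <= t) y).
{ intros t Ht; apply (solves_shift eps a h x t0 N Hx); lra. }
assert (HyM : forall t, 0 <= t -> Rabs (y t) <= M) by (intros t Ht; apply HM; lra).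
assert (Hyk : forall k, solves (oscillating_field eps a h) (fun t => 0 <= t)
                          (fun t => y (t + 2 * INR k * PI))).
{ intros k t Ht; apply (solves_shift eps a h y 0 k Hy).
  generalize (pos_INR k); nra. }
set (p := fun n => y (2 * INR n * PI)).
assert (Hpos : forall n, 0 <= 2 * INR n * PI) by (intros n; generalize (pos_INR n); nra).
assert (HpM : forall n, - M <= p n <= M) by (intros n; apply Rabs_le_between, HyM, Hpos).
assert (HpS : forall n, p (S n) = y (2 * INR n * PI + 2 * INR 1 * PI)).
{ intros n; unfold p; f_equal; rewrite S_INR; simpl; ring. }
assert (Hcv : ex_finite_lim_seq p).
{ destruct (Rle_dec (y 0) (y (0 + 2 * INR 1 * PI))) as [H|H].
  - apply (ex_finite_lim_seq_incr p M); [|intros n; apply HpM].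
    intros n; rewrite HpS.
    apply (solution_order eps a h h1 y (fun t => y (t + 2 * INR 1 * PI)) 0); auto.
    + intros t [Ht _]; apply Hy, Ht.
    + intros t [Ht _]; apply (Hyk 1%nat), Ht.
  - apply (ex_finite_lim_seq_decr p (- M)); [|intros n; apply HpM].
    intros n; rewrite HpS.
    apply (solution_order eps a h h1 (fun t => y (t + 2 * INR 1 * PI)) y 0); auto.
    + intros t [Ht _]; apply (Hyk 1%nat), Ht.
    + intros t [Ht _]; apply Hy, Ht.
    + lra. }
destruct Hcv as [l Hl].
assert (HMa : 0 <= M + a) by lra.
destruct (clipped_solution eps a h h1 (M + a) 0 l He HMa Hh Hc) as [X [HX0 HX]].
destruct (clipped_lipschitz h h1 (M + a) HMa Hh Hc) as [L [HL0 HL]].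
assert (Hdist : forall n s, 0 <= s ->
   Rabs (y (s + 2 * INR n * PI) - X s) <= Rabs (p n - l) * exp (eps * L * s)).
{ intros n s Hs.
  assert (H := gronwall (fun t => y (t + 2 * INR n * PI)) X
     (fun t => oscillating_field eps a (fun z => h (clip (M + a) z)) t (y (t + 2 * INR n * PI)))
     (fun t => oscillating_field eps a (fun z => h (clip (M + a) z)) t (X t)) (eps * L) 0 s Hs).
  cbv beta in H; rewrite HX0, Rminus_0_r, Rplus_0_l in H; apply H.
  - intros t [Ht _]; generalize (Hyk n t Ht); unfold oscillating_field.
    rewrite clip_id; auto.
    apply Rabs_shift_le; auto; apply HyM; generalize (Hpos n); lra.
  - intros t [Ht _]; apply HX, Ht.
  - intros t [Ht _]; apply oscillating_field_lipschitz; [exact He | lra |].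
    eapply Rle_trans; [apply HL|].
    right; do 2 f_equal; ring. }
assert (Hlim : forall s, 0 <= s -> is_lim_seq (fun n => y (s + 2 * INR n * PI)) (X s)).
{ intros s Hs; apply is_lim_seq_dist with (1 := fun n => Hdist n s Hs).
  replace (Finite 0) with (Finite (Rabs (l - l) * exp (eps * L * s)))
    by (rewrite Rminus_diag, Rabs_R0; f_equal; ring).
  apply is_lim_seq_mult'; [|apply is_lim_seq_const].
  apply (is_lim_seq_abs (fun n => p n - l) (l - l)).
  apply is_lim_seq_minus'; [exact Hl | apply is_lim_seq_const]. }
assert (HXM : forall s, 0 <= s -> Rabs (X s) <= M).
{ intros s Hs; rewrite <- (Rminus_0_r (X s)).
  apply (is_lim_seq_Rabs_le _ _ _ _ (Hlim s Hs)).
  intros n; rewrite Rminus_0_r; apply HyM; generalize (Hpos n); lra. }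
assert (HXp : forall t, 0 <= t -> X (t + 2 * PI) = X t).
{ intros t Ht.
  assert (H1 := Hlim t Ht); apply is_lim_seq_incr_1 in H1.
  assert (Ht2 : 0 <= t + 2 * PI) by lra.
  assert (H2 := Hlim (t + 2 * PI) Ht2).
  apply (is_lim_seq_ext _ (fun n => y (t + 2 * PI + 2 * INR n * PI))) in H1.
  - apply is_lim_seq_unique in H1; apply is_lim_seq_unique in H2.
    rewrite H1 in H2; injection H2; auto.
  - intros n; f_equal; rewrite S_INR; ring. }
exists X; split; [|split]; auto.
- intros t Ht; generalize (HX t Ht); unfold oscillating_field.
  rewrite clip_id; auto; apply Rabs_shift_le; auto.
- apply is_lim_spec; intros e.
  assert (Hex := exp_pos (eps * L * (2 * PI))).
  assert (He' : 0 < e / exp (eps * L * (2 * PI))).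
  { apply Rdiv_lt_0_compat; [apply cond_pos | exact Hex]. }
  destruct (proj2 (is_lim_seq_spec _ _) Hl (mkposreal _ He')) as [n0 Hn0].
  simpl in Hn0.
  (* the successor of n0 makes the number of whole periods elapsed at least n0,
     even if the remainder s equals 2 pi *)
  exists (2 * INR N * PI + 2 * INR (S n0) * PI); intros t Ht.
  assert (Ht0 : 0 <= t - 2 * INR N * PI) by (generalize (Hpos (S n0)); lra).
  destruct (period_decomposition _ Ht0) as [k [s [Hs Ets]]].
  assert (Hk : (n0 <= k)%nat).
  { apply INR_le; rewrite S_INR in Ht.
    apply Rmult_le_reg_r with (2 * PI); lra. }
  assert (Et : t = s + 2 * INR k * PI + 2 * INR N * PI) by lra.
  rewrite Rminus_0_r, Rabs_Rabsolu, Et.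
  rewrite (periodic_multiple X N) by (auto; generalize (Hpos k); lra).
  rewrite (periodic_multiple X k) by (auto; lra).
  eapply Rle_lt_trans; [apply (Hdist k s (proj1 Hs))|].
  apply Rle_lt_trans with (Rabs (p k - l) * exp (eps * L * (2 * PI))).
  + apply Rmult_le_compat_l; [apply Rabs_pos|].
    destruct (Req_dec s (2 * PI)) as [->|Hne]; [lra|].
    left; apply exp_increasing, Rmult_lt_compat_l; [nra | lra].
  + specialize (Hn0 k Hk).
    apply Rmult_lt_compat_r with (1 := Hex) in Hn0.
    replace (e / exp (eps * L * (2 * PI)) * exp (eps * L * (2 * PI)))
      with (pos e) in Hn0 by (field; lra).
    exact Hn0.
Qed.

(** * The slope of the derivative at the origin *)

(** Completing f(w)/w at 0 by the derivative d of f makes the infimum defining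
    sigma a minimum over a compact ball. *)
Definition slope (f : R -> R) (d : R) (w : R) : R :=
  if Req_dec_T w 0 then d else f w / w.

Lemma slope_0 (f : R -> R) (d : R) : slope f d 0 = d.
Proof. unfold slope; destruct (Req_dec_T 0 0); [reflexivity | lra]. Qed.

Lemma slope_neq_0 (f : R -> R) (d w : R) : w <> 0 -> slope f d w = f w / w.
Proof. intros Hw; unfold slope; destruct (Req_dec_T w 0); [contradiction | reflexivity]. Qed.

(** At 0, continuity is the definition of the derivative of f. *)
Lemma continuous_slope (f df : R -> R) :
  (forall z, is_derive f z (df z)) -> f 0 = 0 ->
  forall w, continuous (slope f (df 0)) w.
Proof.
intros Hf Hf0 w; destruct (Req_dec w 0) as [->|Hw].
- apply filterlim_locally; intros e.
  destruct (proj1 (is_derive_Reals f 0 (df 0)) (Hf 0) e (cond_pos e)) as [d Hd].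
  exists d; intros z Hz; change (Rabs (z - 0) < d) in Hz; rewrite Rminus_0_r in Hz.
  change (Rabs (slope f (df 0) z - slope f (df 0) 0) < e).
  rewrite slope_0; destruct (Req_dec z 0) as [->|Hz0].
  + rewrite slope_0, Rminus_diag, Rabs_R0; apply cond_pos.
  + rewrite slope_neq_0 by exact Hz0.
    specialize (Hd z Hz0 Hz); rewrite Rplus_0_l, Hf0, Rminus_0_r in Hd; exact Hd.
- apply (continuous_ext_loc _ (fun z => f z / z)).
  + exists (mkposreal _ (Rabs_pos_lt w Hw)); intros z Hz.
    change (Rabs (z - w) < Rabs w) in Hz.
    symmetry; apply slope_neq_0; intros ->.
    rewrite Rminus_0_l, Rabs_Ropp in Hz; lra.
  + apply (ex_derive_continuous (fun z => f z / z)).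
    auto_derive; split; [exists (df w); apply Hf | auto].
Qed.

Lemma RInt_slope (f df : R -> R) (w : R) :
  (forall z, is_derive f z (df z)) -> (forall z, continuous df z) -> f 0 = 0 ->
  RInt (fun l => df (l * w)) 0 1 = slope f (df 0) w.
Proof.
intros Hf Hc Hf0; apply is_RInt_unique; destruct (Req_dec w 0) as [->|Hw].
- rewrite slope_0.
  apply (is_RInt_ext (fun _ => df 0)).
  + intros l _; rewrite Rmult_0_r; reflexivity.
  + assert (H := is_RInt_const (V := R_NormedModule) 0 1 (df 0)).
    apply (eq_ind _ (fun v => is_RInt (fun _ : R => df 0) 0 1 v) H).
    unfold scal; simpl; unfold mult; simpl; ring.
- rewrite slope_neq_0 by exact Hw.
  replace (f w / w) with (minus (f (1 * w) / w) (f (0 * w) / w)).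
  + apply (is_RInt_derive (fun l => f (l * w) / w)).
    * intros l _; auto_derive.
      -- exists (df (l * w)); apply Hf.
      -- rewrite (Derive_eta f _ _ (Hf _)); field; exact Hw.
    * intros l _; apply (continuous_comp (fun l => l * w) df); [|apply Hc].
      apply (ex_derive_continuous (fun l => l * w)); auto_derive; auto.
  + unfold minus, plus, opp; simpl; rewrite Rmult_1_l, Rmult_0_l, Hf0; field; exact Hw.
Qed.

(** The infimum over nonzero w of h'(w)/w is the minimum of its continuous
    extension over the closed ball: dropping the single point 0 does not
    change the infimum of a continuous function. *)
Lemma sigma_h_min (h h2 : R -> R) (r : R) :
  (forall z, is_derive (Derive h) z (h2 z)) -> Derive h 0 = 0 -> 0 < r ->
  is_min_over (fun w => Rabs w <= 2 * r + 1) (slope (Derive h) (h2 0)) (sigma_h h r).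
Proof.
intros Hh Hh0 Hr.
set (S := slope (Derive h) (h2 0)).
assert (Sc : forall w, continuous S w) by (apply continuous_slope; assumption).
destruct (max_over_ball (2 * r + 1) (fun w => - S w)) as [[m [Hm Em]] Hmax]; [lra | |].
{ intros w; apply (continuous_opp S), Sc. }
rewrite <- Em in Hmax.
assert (Hmin : forall w, Rabs w <= 2 * r + 1 -> S m <= S w)
  by (intros w Hw; specialize (Hmax w Hw); simpl in Hmax; lra).
assert (E : forall w, w <> 0 -> w * Derive h w / w ^ 2 = S w).
{ intros w Hw; unfold S; rewrite slope_neq_0 by exact Hw; field; exact Hw. }
assert (Hs : sigma_h h r = S m).
{ unfold sigma_h, inf_over; rewrite (is_glb_Rbar_unique _ (Finite (S m))); [reflexivity|].
  split.
  - intros y [w [Hw ->]]; rewrite E.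
    + apply Hmin, Hw.
    + intros ->; rewrite Rabs_R0 in Hw; lra.
  - intros l Hl.
    assert (Hne : forall w, w <> 0 -> Rabs w <= 2 * r + 1 -> Rbar_le l (S w)).
    { intros w Hw Hwr; apply Hl; exists w; rewrite E by exact Hw.
      repeat split; auto; apply Rabs_pos_lt, Hw. }
    destruct (Req_dec m 0) as [->|Hm0]; [|auto].
    (* a minimum attained at 0 is approached through nonzero points *)
    destruct l as [l| |]; simpl.
    + apply Rnot_lt_le; intros Hlt.
      assert (Hpos : 0 < l - S 0) by lra.
      destruct (proj1 (filterlim_locally S (S 0)) (Sc 0) (mkposreal _ Hpos)) as [d Hd].
      set (w := Rmin (d / 2) 1).
      assert (Hw : 0 < w) by (apply Rmin_glb_lt; [apply is_pos_div_2 | lra]).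
      assert (Hw1 : w <= 1) by apply Rmin_r.
      assert (Hwd : w <= d / 2) by apply Rmin_l.
      assert (Hdp := cond_pos d).
      assert (Hle : l <= S w) by (apply Hne; [lra | rewrite Rabs_pos_eq by lra; lra]).
      assert (Hw' : Rabs (S w - S 0) < l - S 0).
      { apply Hd; change (Rabs (w - 0) < d).
        rewrite Rminus_0_r, Rabs_pos_eq by lra; lra. }
      apply Rabs_def2 in Hw'; lra.
    + apply (Hne 1); [lra | rewrite Rabs_R1; lra].
    + exact I. }
rewrite Hs; split; [exists m; auto | exact Hmin].
Qed.

(** * Averaging over one period *)

Lemma shift_2PI (t : R) : sin (t + 2 * PI) = sin t /\ cos (t + 2 * PI) = cos t.
Proof.
replace (t + 2 * PI) with (t + 2 * INR 1 * PI) by (simpl; ring).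
split; [apply sin_period | apply cos_period].
Qed.

Lemma Rabs_oscillating_field_le (eps a : R) (h : R -> R) (H t x : R) :
  0 < eps -> Rabs (h (x + a * sin t)) <= H -> Rabs (oscillating_field eps a h t x) <= eps * H.
Proof.
intros He Hh; unfold oscillating_field; rewrite !Rabs_mult, Rabs_Ropp, (Rabs_pos_eq eps) by lra.
rewrite Rmult_assoc; apply Rmult_le_compat_l; [lra|].
generalize (Rabs_sin_le_1 t) (Rabs_pos (sin t)) (Rabs_pos (h (x + a * sin t))); nra.
Qed.

Lemma solution_drift (eps a : R) (h x : R -> R) (H s t : R) :
  0 < eps -> 0 <= H -> s <= t <= s + 2 * PI ->
  solves (oscillating_field eps a h) (fun t => s <= t <= s + 2 * PI) x ->
  (forall t, s <= t <= s + 2 * PI -> Rabs (h (x t + a * sin t)) <= H) ->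
  Rabs (x t - x s) <= 2 * PI * eps * H.
Proof.
intros He H0 Ht Hx Hb.
apply Rle_trans with (eps * H * (t - s)).
- apply (increment_le_linear x (fun t => oscillating_field eps a h t (x t))); [lra | |].
  + intros u Hu; apply Hx; lra.
  + intros u Hu; apply Rabs_oscillating_field_le; [exact He|]; apply Hb; lra.
- assert (0 <= eps * H) by nra; nra.
Qed.

(** With y = x(s), the function sin t (h(y) + a sin t h'(y) + (a sin t)^2/2 h''(y))
    has an explicit primitive, which increases by a pi h'(y) over a period.
    Adding eps times this primitive to x leaves a function whose derivative is
    - eps sin t times the sum of a Taylor remainder of h and of the effect on h
    of the drift of x away from y. *)
Lemma period_increment (eps a : R) (h h1 h2 h3 x : R -> R) (s rho H L c : R) :
  0 < eps -> 0 < a -> 0 <= H ->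
  (forall z, is_derive h z (h1 z)) ->
  (forall z, is_derive h1 z (h2 z)) ->
  (forall z, is_derive h2 z (h3 z)) ->
  (forall z, Rabs z <= rho + a -> Rabs (h z) <= H) ->
  (forall z, Rabs z <= rho + a -> Rabs (h1 z) <= L) ->
  (forall z, Rabs z <= rho + a -> Rabs (h3 z) <= c) ->
  solves (oscillating_field eps a h) (fun t => s <= t <= s + 2 * PI) x ->
  (forall t, s <= t <= s + 2 * PI -> Rabs (x t) <= rho) ->
  Rabs (x (s + 2 * PI) - x s + eps * (a * PI * h1 (x s)))
    <= eps * (PI * a ^ 3 * c / 6 + 4 * PI ^ 2 * eps * H * L).
Proof.
intros He Ha H0 Hh Hh1 Hh2 HH HL Hc Hx Hrho.
assert (HP := PI_RGT_0).
set (y := x s).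
assert (Hy : Rabs y <= rho) by (apply Hrho; lra).
assert (L0 : 0 <= L).
{ eapply Rle_trans; [apply Rabs_pos | apply (HL y); lra]. }
assert (c0 : 0 <= c).
{ eapply Rle_trans; [apply Rabs_pos | apply (Hc y); lra]. }
(* (t - sin t cos t)/2 is a primitive of sin^2, and - cos t + cos^3 t/3 one of
   sin^3 *)
set (Phi := fun t => x t + eps * (- cos t * h y + a * h1 y * ((t - sin t * cos t) / 2)
                 + a ^ 2 / 2 * h2 y * (- cos t + cos t ^ 3 / 3))).
(* sin^4 is bounded by sin^2 in the Taylor remainder, which produces the
   denominator 6 *)
set (G := fun t => eps * (L * (2 * PI * eps * H) * t
                 + c * a ^ 3 / 6 * ((t - sin t * cos t) / 2))).
assert (B : Rabs (Phi (s + 2 * PI) - Phi s) <= G (s + 2 * PI) - G s).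
{ apply (increment_abs_bound Phi
    (fun t => - (eps * (sin t * (h (x t + a * sin t) - h y - a * sin t * h1 y
                                 - (a * sin t) ^ 2 / 2 * h2 y))))
    G (fun t => eps * (L * (2 * PI * eps * H) + c * a ^ 3 / 6 * sin t ^ 2))); [lra| | |].
  - intros t Ht; unfold Phi; auto_derive.
    + exists (oscillating_field eps a h t (x t)); apply Hx, Ht.
    + rewrite (Derive_eta x _ _ (Hx t Ht)); unfold oscillating_field.
      assert (Hsc : cos t * cos t = 1 - sin t * sin t).
      { generalize (sin2_cos2 t); unfold Rsqr; lra. }
      replace (1 * (- (1) * sin t) * (INR 3 * cos t ^ pred 3))
        with (- 3 * sin t * (cos t * cos t)) by (simpl; ring).
      field_simplify; replace (cos t ^ 2) with (cos t * cos t) by ring;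
      rewrite Hsc; field.
  - intros t Ht; unfold G; auto_derive; auto.
    assert (Hsc : cos t * cos t = 1 - sin t * sin t).
    { generalize (sin2_cos2 t); unfold Rsqr; lra. }
    field_simplify; replace (cos t ^ 2) with (cos t * cos t) by ring;
    rewrite Hsc; field.
  - intros t Ht.
    rewrite Rabs_Ropp, !Rabs_mult, (Rabs_pos_eq eps) by lra.
    apply Rmult_le_compat_l; [lra|].
    assert (T1 : Rabs (h (y + a * sin t) - h y - a * sin t * h1 y
                       - (a * sin t) ^ 2 / 2 * h2 y) <= c * Rabs (a * sin t) ^ 3 / 6).
    { apply (taylor_order3 h h1 h2 h3 c (rho + a)); auto; [lra|].
      apply Rabs_shift_le; auto. }
    assert (T2 : Rabs (h (x t + a * sin t) - h (y + a * sin t)) <= L * (2 * PI * eps * H)).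
    { eapply Rle_trans.
      - apply (lipschitz_on_ball h h1 L (rho + a) Hh HL); apply Rabs_shift_le; auto.
      - apply Rmult_le_compat_l; [exact L0|].
        replace (x t + a * sin t - (y + a * sin t)) with (x t - y) by ring.
        apply (solution_drift eps a h); auto.
        intros u Hu; apply HH, Rabs_shift_le; auto. }
    rewrite Rabs_mult, (Rabs_pos_eq a) in T1 by lra.
    assert (T : Rabs (h (x t + a * sin t) - h y - a * sin t * h1 y
                      - (a * sin t) ^ 2 / 2 * h2 y)
                <= L * (2 * PI * eps * H) + c * (a * Rabs (sin t)) ^ 3 / 6).
    { replace (h (x t + a * sin t) - h y - a * sin t * h1 y - (a * sin t) ^ 2 / 2 * h2 y)
        with ((h (x t + a * sin t) - h (y + a * sin t)) +
              (h (y + a * sin t) - h y - a * sin t * h1 y - (a * sin t) ^ 2 / 2 * h2 y)) by ring.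
      eapply Rle_trans; [apply Rabs_triang | lra]. }
    rewrite <- (pow2_abs (sin t)).
    assert (S0 := Rabs_pos (sin t)); assert (S1 := Rabs_sin_le_1 t).
    set (sa := Rabs (sin t)) in *.
    apply Rle_trans with (sa * (L * (2 * PI * eps * H) + c * (a * sa) ^ 3 / 6)).
    + apply Rmult_le_compat_l; auto.
    + assert (P1 : 0 <= L * (2 * PI * eps * H)).
      { assert (0 <= eps * H) by nra; assert (0 <= PI * (eps * H)) by nra; nra. }
      assert (P2 : 0 <= c * a ^ 3 / 6).
      { apply Rdiv_le_0_compat; [|lra]; apply Rmult_le_pos; [lra|]; apply pow_le; lra. }
      replace (sa * (L * (2 * PI * eps * H) + c * (a * sa) ^ 3 / 6))
        with (sa * (L * (2 * PI * eps * H)) + c * a ^ 3 / 6 * (sa ^ 2 * sa ^ 2)) by field.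
      assert (Q : sa ^ 2 * sa ^ 2 <= 1 * sa ^ 2).
      { apply Rmult_le_compat_r; [apply pow2_ge_0|]; simpl; nra. }
      rewrite Rmult_1_l in Q.
      apply Rplus_le_compat; [nra | apply Rmult_le_compat_l; assumption]. }
unfold Phi, G in B.
destruct (shift_2PI s) as [Es Ec]; rewrite Es, Ec in B.
fold y in B.
match goal with |- Rabs ?l <= ?m =>
  match type of B with Rabs ?l' <= ?m' =>
    replace l with l' by field; replace m with m' by field; exact B
  end
end.
Qed.

(** * Contraction between periodic solutions *)

(** The function ln (u - v) - eps cos t (h(u) - h(v))/(u - v) would decrease
    over a period although it is periodic. In the derivative of ln (u - v) the
    term - eps sin t (h(u) - h(v))/(u - v) is of order eps with no definite
    sign; subtracting eps cos t (h(u) - h(v))/(u - v) removes it at the cost of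
    terms of order eps^2, because the quotient itself varies at speed O(eps).
    What remains at order eps is - eps a sin^2 t times a quantity that
    is at least h''(0) - c rho - c a / 2. *)
Lemma no_two_periodic_solutions (eps a : R) (h h1 h2 h3 u v : R -> R)
  (rho H L L2 c : R) :
  0 < eps -> 0 < a ->
  (forall z, is_derive h z (h1 z)) ->
  (forall z, is_derive h1 z (h2 z)) ->
  (forall z, is_derive h2 z (h3 z)) ->
  (forall z, Rabs z <= rho + a -> Rabs (h z) <= H) ->
  (forall z, Rabs z <= rho + a -> Rabs (h1 z) <= L) ->
  (forall z, Rabs z <= rho + a -> Rabs (h2 z) <= L2) ->
  (forall z, Rabs z <= rho + a -> Rabs (h3 z) <= c) ->
  2 * eps * (L2 * H + 2 * L ^ 2) < a * (h2 0 - c * rho - c * a / 2) ->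
  solves (oscillating_field eps a h) (fun t => 0 <= t) u ->
  solves (oscillating_field eps a h) (fun t => 0 <= t) v ->
  (forall t, 0 <= t -> Rabs (u t) <= rho) ->
  (forall t, 0 <= t -> Rabs (v t) <= rho) ->
  u (2 * PI) = u 0 -> v (2 * PI) = v 0 ->
  ~ (forall t, 0 <= t <= 2 * PI -> v t < u t).
Proof.
intros He Ha Hh Hh1 Hh2 HH HL HL2 Hc Hsmall Hu Hv Hru Hrv Pu Pv Huv.
assert (HP := PI_RGT_0).
assert (R0 : 0 <= rho) by (generalize (Hru 0 (Rle_refl 0)) (Rabs_pos (u 0)); lra).
assert (Z0 : Rabs 0 <= rho + a) by (rewrite Rabs_R0; lra).
assert (H0 : 0 <= H) by (eapply Rle_trans; [apply Rabs_pos | apply (HH 0 Z0)]).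
assert (L0 : 0 <= L) by (eapply Rle_trans; [apply Rabs_pos | apply (HL 0 Z0)]).
assert (L20 : 0 <= L2) by (eapply Rle_trans; [apply Rabs_pos | apply (HL2 0 Z0)]).
assert (c0 : 0 <= c) by (eapply Rle_trans; [apply Rabs_pos | apply (Hc 0 Z0)]).
set (p0 := fun t => (h (u t) - h (v t)) / (u t - v t)).
set (p1 := fun t => (h1 (u t) - h1 (v t)) / (u t - v t)).
set (pS := fun t => (h (u t + a * sin t) - h (v t + a * sin t)) / (u t - v t)).
set (V := fun t => ln (u t - v t) - eps * cos t * p0 t).
set (C := L2 * H + 2 * L ^ 2).
set (kappa := h2 0 - c * rho - c * a / 2).
fold C kappa in Hsmall.
assert (B : V (2 * PI) - V 0 <=
   (fun t => - (eps * a * kappa) * ((t - sin t * cos t) / 2) + eps ^ 2 * C * t) (2 * PI) -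
   (fun t => - (eps * a * kappa) * ((t - sin t * cos t) / 2) + eps ^ 2 * C * t) 0).
{ apply (increment_bound V
    (fun t => - (eps * sin t * pS t) + eps * sin t * p0 t
              - eps * cos t * (p1 t * oscillating_field eps a h t (u t)
                  - h1 (v t) * (eps * sin t * pS t) + p0 t * (eps * sin t * pS t)))
    (fun t => - (eps * a * kappa) * ((t - sin t * cos t) / 2) + eps ^ 2 * C * t)
    (fun t => - (eps * a * kappa) * sin t ^ 2 + eps ^ 2 * C)); [lra| | |].
  - intros t Ht; specialize (Huv t Ht).
    assert (Hut := Hu t (proj1 Ht)); assert (Hvt := Hv t (proj1 Ht)).
    unfold V, p0; auto_derive.
    + repeat split; try (eexists; eassumption); try lra.
      * exists (h1 (u t)); apply Hh.
      * exists (h1 (v t)); apply Hh.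
    + rewrite (Derive_eta u _ _ Hut), (Derive_eta v _ _ Hvt),
        (Derive_eta h _ _ (Hh (u t))), (Derive_eta h _ _ (Hh (v t))).
      unfold p1, pS, oscillating_field; field; lra.
  - intros t _; auto_derive; auto.
    assert (Hsc : cos t * cos t = 1 - sin t * sin t).
    { generalize (sin2_cos2 t); unfold Rsqr; lra. }
    field_simplify; replace (cos t ^ 2) with (cos t * cos t) by ring;
    rewrite Hsc; field.
  - intros t Ht; specialize (Huv t Ht).
    assert (Ru := Hru t (proj1 Ht)); assert (Rv := Hrv t (proj1 Ht)).
    assert (Ru' : Rabs (u t) <= rho + a) by lra.
    assert (Rv' : Rabs (v t) <= rho + a) by lra.
    assert (Su := Rabs_shift_le a _ _ t Ha Ru); assert (Sv := Rabs_shift_le a _ _ t Ha Rv).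
    assert (D0 : 0 < u t - v t) by lra.
    assert (Hdiv : forall N X, Rabs N <= X * Rabs (u t - v t) -> Rabs (N / (u t - v t)) <= X).
    { intros N X HN; unfold Rdiv; rewrite Rabs_mult, Rabs_inv.
      rewrite (Rabs_pos_eq (u t - v t)) in * by lra.
      apply Rmult_le_reg_r with (u t - v t); [exact D0|].
      replace (Rabs N * / (u t - v t) * (u t - v t)) with (Rabs N) by (field; lra).
      exact HN. }
    assert (B0 : Rabs (p0 t) <= L).
    { apply Hdiv, (lipschitz_on_ball h h1 L (rho + a)); auto. }
    assert (B1 : Rabs (p1 t) <= L2).
    { apply Hdiv, (lipschitz_on_ball h1 h2 L2 (rho + a)); auto. }
    assert (BS : Rabs (pS t) <= L).
    { apply Hdiv; replace (u t - v t) with ((u t + a * sin t) - (v t + a * sin t)) by ring.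
      apply (lipschitz_on_ball h h1 L (rho + a)); auto. }
    assert (BU : Rabs (oscillating_field eps a h t (u t)) <= eps * H)
      by (apply Rabs_oscillating_field_le; auto).
    assert (Bh : Rabs (h1 (v t)) <= L) by auto.
    assert (Between : forall z, v t <= z <= u t -> Rabs z <= rho).
    { intros z Hz; apply Rabs_le_between in Ru; apply Rabs_le_between in Rv.
      apply Rabs_le; lra. }
    assert (Low : h2 0 - c * rho <= p1 t).
    { apply Rmult_le_reg_r with (u t - v t); [exact D0|].
      unfold p1; replace ((h1 (u t) - h1 (v t)) / (u t - v t) * (u t - v t))
        with (h1 (u t) - h1 (v t)) by (field; lra).
      replace ((h2 0 - c * rho) * (u t - v t))
        with ((fun z => (h2 0 - c * rho) * z) (u t) - (fun z => (h2 0 - c * rho) * z) (v t)) by ring.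
      apply (increment_bound _ (fun _ => h2 0 - c * rho) h1 h2); [lra| | |].
      - intros z _; auto_derive; auto; ring.
      - auto.
      - intros z Hz; specialize (Between z Hz).
        assert (HB := lipschitz_on_ball h2 h3 c (rho + a) Hh2 Hc z 0).
        rewrite Rminus_0_r in HB.
        assert (HB' : Rabs (h2 z - h2 0) <= c * Rabs z) by (apply HB; auto; lra).
        apply Rabs_le_between in HB'.
        assert (c * Rabs z <= c * rho) by (apply Rmult_le_compat_l; lra).
        lra. }
    assert (Rem : Rabs (pS t - p0 t - a * sin t * p1 t) <= c * (a * sin t) ^ 2 / 2).
    { replace (pS t - p0 t - a * sin t * p1 t) with
        (((fun x => h (x + a * sin t) - h x - a * sin t * h1 x) (u t) -
          (fun x => h (x + a * sin t) - h x - a * sin t * h1 x) (v t)) / (u t - v t))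
        by (unfold pS, p0, p1; field; lra).
      apply Hdiv; rewrite (Rabs_pos_eq (u t - v t)) by lra.
      apply (increment_le_linear (fun x => h (x + a * sin t) - h x - a * sin t * h1 x)
               (fun x => h1 (x + a * sin t) - h1 x - a * sin t * h2 x)); [lra| |].
      - intros x _; auto_derive.
        + repeat split; [exists (h1 (x + a * sin t)) | exists (h1 x) | exists (h2 x)]; auto.
        + rewrite (Derive_eta h _ _ (Hh (x + a * sin t))), (Derive_eta h _ _ (Hh x)),
            (Derive_eta h1 _ _ (Hh1 x)); ring.
      - intros x Hx; specialize (Between x Hx).
        apply (taylor_order2 h1 h2 h3 c (rho + a)); auto; [lra|].
        apply Rabs_shift_le; auto. }
    set (s := sin t) in *; set (k := cos t) in *.
    assert (Ss : Rabs s <= 1) by apply Rabs_sin_le_1.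
    assert (Sk : Rabs k <= 1) by (apply Rabs_le, COS_bound).
    (* the part of order eps *)
    assert (Main : - (eps * s * pS t) + eps * s * p0 t <= - (eps * a * kappa) * s ^ 2).
    { set (e := pS t - p0 t - a * s * p1 t) in *.
      replace (- (eps * s * pS t) + eps * s * p0 t)
        with (eps * (- (s * e) - a * s ^ 2 * p1 t)) by (unfold e; ring).
      replace (- (eps * a * kappa) * s ^ 2) with (eps * (- (a * kappa) * s ^ 2)) by ring.
      apply Rmult_le_compat_l; [lra|].
      assert (M1 : - (s * e) <= c * (a * s) ^ 2 / 2).
      { eapply Rle_trans; [apply Rle_abs|]; rewrite Rabs_Ropp, Rabs_mult.
        generalize (Rabs_pos e) (Rabs_pos s); nra. }
      assert (M2 : a * s ^ 2 * (h2 0 - c * rho) <= a * s ^ 2 * p1 t).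
      { apply Rmult_le_compat_l; [|exact Low].
        apply Rmult_le_pos; [lra | apply pow2_ge_0]. }
      unfold kappa; lra. }
    (* the remaining terms are of order eps^2 *)
    assert (Rest : Rabs (eps * k * (p1 t * oscillating_field eps a h t (u t)
                   - h1 (v t) * (eps * s * pS t) + p0 t * (eps * s * pS t))) <= eps ^ 2 * C).
    { assert (A1 : Rabs (eps * s * pS t) <= eps * L).
      { rewrite !Rabs_mult, (Rabs_pos_eq eps), Rmult_assoc by lra.
        apply Rmult_le_compat_l; [lra|].
        rewrite <- (Rmult_1_l L); apply Rmult_le_compat; auto using Rabs_pos. }
      set (q := eps * s * pS t) in *.
      assert (A2 : Rabs (p1 t * oscillating_field eps a h t (u t)) <= L2 * (eps * H)).
      { rewrite Rabs_mult; apply Rmult_le_compat; auto using Rabs_pos. }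
      assert (A3 : Rabs (h1 (v t) * q) <= L * (eps * L)).
      { rewrite Rabs_mult; apply Rmult_le_compat; auto using Rabs_pos. }
      assert (A4 : Rabs (p0 t * q) <= L * (eps * L)).
      { rewrite Rabs_mult; apply Rmult_le_compat; auto using Rabs_pos. }
      set (w := p1 t * oscillating_field eps a h t (u t) - h1 (v t) * q + p0 t * q).
      assert (A5 : Rabs w <= eps * C).
      { apply Rabs_le_between in A2; apply Rabs_le_between in A3;
        apply Rabs_le_between in A4; apply Rabs_le; unfold w, C; lra. }
      rewrite !Rabs_mult, (Rabs_pos_eq eps) by lra.
      replace (eps ^ 2 * C) with (eps * 1 * (eps * C)) by ring.
      apply Rmult_le_compat; auto using Rabs_pos.
      - apply Rmult_le_pos; [lra | apply Rabs_pos].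
      - apply Rmult_le_compat_l; lra. }
    apply Rabs_le_between in Rest; lra. }
assert (EV : V (2 * PI) = V 0).
{ unfold V, p0; rewrite Pu, Pv, cos_2PI, cos_0; reflexivity. }
cbv beta in B; rewrite EV, sin_2PI, cos_2PI, sin_0 in B.
assert (Hneg : eps * PI * (2 * eps * C - a * kappa) < 0).
{ assert (0 < eps * PI) by (apply Rmult_lt_0_compat; lra). nra. }
assert (eps * PI * (2 * eps * C - a * kappa) =
        - (eps * a * kappa) * ((2 * PI - 0 * 1) / 2) + eps ^ 2 * C * (2 * PI)) by field.
lra.
Qed.

(** If the solutions never met, one would lie strictly above the other during
    a whole period. Once they meet they agree forever after, hence always by
    periodicity. *)
Lemma small_periodic_unique (eps a : R) (h h1 h2 h3 u v : R -> R)
  (rho H L L2 c : R) :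
  0 < eps -> 0 < a ->
  (forall z, is_derive h z (h1 z)) ->
  (forall z, is_derive h1 z (h2 z)) ->
  (forall z, is_derive h2 z (h3 z)) ->
  (forall z, Rabs z <= rho + a -> Rabs (h z) <= H) ->
  (forall z, Rabs z <= rho + a -> Rabs (h1 z) <= L) ->
  (forall z, Rabs z <= rho + a -> Rabs (h2 z) <= L2) ->
  (forall z, Rabs z <= rho + a -> Rabs (h3 z) <= c) ->
  2 * eps * (L2 * H + 2 * L ^ 2) < a * (h2 0 - c * rho - c * a / 2) ->
  solves (oscillating_field eps a h) (fun t => 0 <= t) u ->
  solves (oscillating_field eps a h) (fun t => 0 <= t) v ->
  (forall t, 0 <= t -> Rabs (u t) <= rho) ->
  (forall t, 0 <= t -> Rabs (v t) <= rho) ->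
  (forall t, 0 <= t -> u (t + 2 * PI) = u t) ->
  (forall t, 0 <= t -> v (t + 2 * PI) = v t) ->
  forall t, 0 <= t -> u t = v t.
Proof.
intros He Ha Hh Hh1 Hh2 HH HL HL2 Hc Hsmall Hu Hv Hru Hrv Pu Pv.
assert (HP := PI_RGT_0).
assert (Ch1 : forall z, continuous h1 z)
  by (intros z; apply (ex_derive_continuous h1); exists (h2 z); auto).
assert (Forward : forall s t, 0 <= s <= t -> u s = v s -> u t = v t).
{ intros s t Hst; apply (solution_unique eps a h h1 u v s t); auto; try lra;
    intros r Hr; [apply Hu | apply Hv]; lra. }
assert (Meet : (exists s, 0 <= s <= 2 * PI /\ u s = v s) ->
               forall t, 0 <= t -> u t = v t).
{ intros [s [Hs Es]] t Ht.
  rewrite <- (Pu t Ht), <- (Pv t Ht); apply (Forward s); [lra | exact Es]. }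
destruct (Req_dec (u 0) (v 0)) as [E|E].
{ apply Meet; exists 0; split; [lra | exact E]. }
assert (Sep : forall x y,
  solves (oscillating_field eps a h) (fun t => 0 <= t) x ->
  solves (oscillating_field eps a h) (fun t => 0 <= t) y ->
  (forall t, 0 <= t -> Rabs (x t) <= rho) ->
  (forall t, 0 <= t -> Rabs (y t) <= rho) ->
  (forall t, 0 <= t -> x (t + 2 * PI) = x t) ->
  (forall t, 0 <= t -> y (t + 2 * PI) = y t) ->
  y 0 < x 0 -> exists s, 0 <= s <= 2 * PI /\ y s = x s).
{ intros x y Hx Hy Hrx Hry Px Py Hlt; apply NNPP; intros Hno.
  apply (no_two_periodic_solutions eps a h h1 h2 h3 x y rho H L L2 c); auto.
  - rewrite <- (Px 0), Rplus_0_l by lra; reflexivity.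
  - rewrite <- (Py 0), Rplus_0_l by lra; reflexivity.
  - intros t Ht; apply Rnot_le_lt; intros Hle.
    apply Hno; destruct (Rle_lt_or_eq_dec _ _ Hle) as [Hl|Hl].
    + destruct (crossing y x 0 t) as [s [Hs Es]]; try lra.
      * intros r Hr; apply (ex_derive_continuous y); eexists; apply Hy; lra.
      * intros r Hr; apply (ex_derive_continuous x); eexists; apply Hx; lra.
      * exists s; split; [lra | auto].
    + exists t; auto. }
apply Meet; destruct (Rlt_dec (v 0) (u 0)) as [Hlt|Hge].
- destruct (Sep u v) as [s [Hs Es]]; auto; exists s; auto.
- destruct (Sep v u) as [s [Hs Es]]; auto; [lra|]; exists s; auto.
Qed.

(** * The return map and trapping *)

(** By [period_increment] the change over a period is - eps a pi (h'(y) + e)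
    with y = x(s) and |e| <= sigma beta, while h'(y) has the sign of y and
    modulus at least sigma |y|. The bound 2 r on x during the period keeps x + a sin t in the ball where H, L
    and c are valid bounds. *)
Lemma return_map (eps a : R) (h h1 h2 h3 x : R -> R) (s r H L c sigma : R) :
  0 < eps -> 0 < a <= 1 -> 0 < r -> 0 < sigma -> 0 <= H ->
  (forall z, is_derive h z (h1 z)) ->
  (forall z, is_derive h1 z (h2 z)) ->
  (forall z, is_derive h2 z (h3 z)) ->
  (forall z, Rabs z <= 2 * r + 2 -> Rabs (h z) <= H) ->
  (forall z, Rabs z <= 3 * r + 2 -> Rabs (h1 z) <= L) ->
  (forall z, Rabs z <= 2 * r + 2 -> Rabs (h3 z) <= c) ->
  (forall w, 0 < Rabs w <= 2 * r + 1 -> sigma <= h1 w / w) ->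
  solves (oscillating_field eps a h) (fun t => s <= t <= s + 2 * PI) x ->
  (forall t, s <= t <= s + 2 * PI -> Rabs (x t) <= 2 * r) ->
  let beta := a ^ 2 * c / (6 * sigma) + 4 * PI * eps * H * L / (a * sigma) in
  (beta < x s -> x (s + 2 * PI) < x s) /\ (x s < - beta -> x s < x (s + 2 * PI)).
Proof.
intros He [Ha Ha1] Hr Hsig H0 Hh Hh1 Hh2 HH HL Hc Hslope Hx Hrx beta.
assert (HP := PI_RGT_0).
assert (Hxs : Rabs (x s) <= 2 * r) by (apply Hrx; lra).
assert (L0 : 0 <= L).
{ eapply Rle_trans; [apply Rabs_pos | apply (HL 0); rewrite Rabs_R0; lra]. }
assert (c0 : 0 <= c).
{ eapply Rle_trans; [apply Rabs_pos | apply (Hc 0); rewrite Rabs_R0; lra]. }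
assert (beta0 : 0 <= beta).
{ unfold beta; apply Rplus_le_le_0_compat; apply Rdiv_le_0_compat; try nra.
  assert (0 <= PI * eps) by nra; assert (0 <= PI * eps * H) by nra; nra. }
assert (I := period_increment eps a h h1 h2 h3 x s (2 * r) H L c He Ha H0 Hh Hh1 Hh2).
assert (I' : Rabs (x (s + 2 * PI) - x s + eps * (a * PI * h1 (x s)))
             <= eps * (a * PI * (sigma * beta))).
{ replace (eps * (a * PI * (sigma * beta)))
    with (eps * (PI * a ^ 3 * c / 6 + 4 * PI ^ 2 * eps * H * L))
    by (unfold beta; field; lra).
  apply I; auto; intros z Hz; [apply HH | apply HL | apply Hc]; lra. }
apply Rabs_le_between in I'.
assert (E : 0 < eps * (a * PI)) by (apply Rmult_lt_0_compat; [|apply Rmult_lt_0_compat]; lra).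
split; intros Hb.
- assert (Hs : sigma <= h1 (x s) / x s).
  { apply Hslope; rewrite Rabs_pos_eq in * by lra; lra. }
  assert (Hs' : sigma * x s <= h1 (x s)).
  { replace (h1 (x s)) with (h1 (x s) / x s * x s) by (field; lra).
    apply Rmult_le_compat_r; lra. }
  assert (sigma * beta < h1 (x s)) by nra.
  assert (eps * (a * PI) * (sigma * beta) < eps * (a * PI) * h1 (x s))
    by (apply Rmult_lt_compat_l; lra).
  lra.
- assert (Hs : sigma <= h1 (x s) / x s).
  { apply Hslope; rewrite Rabs_left in * by lra; lra. }
  assert (Hs' : h1 (x s) <= sigma * x s).
  { replace (h1 (x s)) with (h1 (x s) / x s * x s) by (field; lra).
    assert (x s < 0) by lra; nra. }
  assert (h1 (x s) < - (sigma * beta)) by nra.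
  assert (eps * (a * PI) * h1 (x s) < eps * (a * PI) * - (sigma * beta))
    by (apply Rmult_lt_compat_l; lra).
  lra.
Qed.

(** A solution of the clipped equation moves by at most 2 pi eps H during a
    period. Its samples at whole periods stay in [-r, r]: those beyond beta
    move towards 0 without overshooting, the others have room to move. Between
    samples its modulus stays below 2 r, where clipping is inactive. *)
Lemma trapped_solution (eps a : R) (h h1 h2 h3 : R -> R) (t0 x0 r H L c sigma : R) :
  0 < eps -> 0 < a <= 1 -> 0 < r -> 0 < sigma -> 0 <= H ->
  (forall z, is_derive h z (h1 z)) ->
  (forall z, is_derive h1 z (h2 z)) ->
  (forall z, is_derive h2 z (h3 z)) ->
  (forall z, Rabs z <= 2 * r + 2 -> Rabs (h z) <= H) ->
  (forall z, Rabs z <= 3 * r + 2 -> Rabs (h1 z) <= L) ->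
  (forall z, Rabs z <= 2 * r + 2 -> Rabs (h3 z) <= c) ->
  (forall w, 0 < Rabs w <= 2 * r + 1 -> sigma <= h1 w / w) ->
  a ^ 2 * c / (6 * sigma) + 4 * PI * eps * H * L / (a * sigma) + 2 * PI * eps * H <= r ->
  Rabs x0 <= r ->
  exists x, x t0 = x0 /\
    solves (oscillating_field eps a h) (fun t => t0 <= t) x /\
    (forall t, t0 <= t -> Rabs (x t) <= 2 * r).
Proof.
intros He Ha Hr Hsig H0 Hh Hh1 Hh2 HH HL Hc Hslope Hsmall Hx0.
assert (HP := PI_RGT_0).
assert (Ch1 : forall z, continuous h1 z)
  by (intros z; apply (ex_derive_continuous h1); exists (h2 z); auto).
set (m := 2 * r + 1).
assert (M0 : 0 <= m) by (unfold m; lra).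
set (beta := a ^ 2 * c / (6 * sigma) + 4 * PI * eps * H * L / (a * sigma)) in *.
assert (L0 : 0 <= L).
{ eapply Rle_trans; [apply Rabs_pos | apply (HL 0); rewrite Rabs_R0; lra]. }
assert (c0 : 0 <= c).
{ eapply Rle_trans; [apply Rabs_pos | apply (Hc 0); rewrite Rabs_R0; lra]. }
assert (beta0 : 0 <= beta).
{ unfold beta; apply Rplus_le_le_0_compat; apply Rdiv_le_0_compat; try nra.
  assert (0 <= PI * eps) by nra; assert (0 <= PI * eps * H) by nra; nra. }
destruct (clipped_solution eps a h h1 m t0 x0 He M0 Hh Ch1) as [x [Ex Hx]].
assert (Hpos : forall n, 0 <= 2 * INR n * PI) by (intros n; generalize (pos_INR n); nra).
assert (Drift : forall s t, t0 <= s -> s <= t <= s + 2 * PI ->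
          Rabs (x t - x s) <= 2 * PI * eps * H).
{ intros s t Hs Ht.
  apply (solution_drift eps a (fun z => h (clip m z))); auto.
  - intros q Hq; apply Hx; lra.
  - intros q _; apply HH; eapply Rle_trans; [apply Rabs_clip_le, M0 | unfold m; lra]. }
assert (Near : forall s t, t0 <= s -> s <= t <= s + 2 * PI ->
          Rabs (x s) <= r -> Rabs (x t) <= 2 * r).
{ intros s t Hs Ht Hxs; specialize (Drift s t Hs Ht).
  apply Rabs_le_between in Drift; apply Rabs_le_between in Hxs; apply Rabs_le; lra. }
assert (Unclip : forall t, t0 <= t -> Rabs (x t) <= 2 * r ->
          is_derive x t (oscillating_field eps a h t (x t))).
{ intros t Ht Hxt; generalize (Hx t Ht); unfold oscillating_field; rewrite clip_id; auto.
  eapply Rle_trans; [apply Rabs_shift_le with (2 := Hxt); lra | unfold m; lra]. }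
assert (Hn : forall n, Rabs (x (t0 + 2 * INR n * PI)) <= r).
{ induction n as [|n IH].
  - simpl; replace (t0 + 2 * 0 * PI) with t0 by ring; rewrite Ex; exact Hx0.
  - set (s := t0 + 2 * INR n * PI) in *.
    replace (t0 + 2 * INR (S n) * PI) with (s + 2 * PI)
      by (unfold s; rewrite S_INR; ring).
    assert (Hs : t0 <= s) by (unfold s; specialize (Hpos n); lra).
    destruct (return_map eps a h h1 h2 h3 x s r H L c sigma) as [Up Down]; auto.
    + intros t Ht; apply Unclip; [lra | apply (Near s); auto].
    + intros t Ht; apply (Near s); auto.
    + fold beta in Up, Down.
      assert (D : Rabs (x (s + 2 * PI) - x s) <= 2 * PI * eps * H)
        by (apply Drift; lra).
      apply Rabs_le_between in D; apply Rabs_le_between in IH; apply Rabs_le.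
      destruct (Rlt_dec beta (x s)); destruct (Rlt_dec (x s) (- beta)); lra. }
assert (Hbd : forall t, t0 <= t -> Rabs (x t) <= 2 * r).
{ intros t Ht.
  assert (Ht0 : 0 <= t - t0) by lra.
  destruct (period_decomposition _ Ht0) as [k [s [Hs Es]]].
  apply (Near (t0 + 2 * INR k * PI)); auto; specialize (Hpos k); lra. }
exists x; split; [exact Ex | split; [|exact Hbd]].
intros t Ht; apply Unclip; auto.
Qed.

(** A value of a periodic function is the limit of the values of x at the
    times congruent to s modulo 2 pi. *)
Lemma periodic_limit_bound (x xs : R -> R) (t0 s r : R) :
  0 <= s ->
  (forall t, 0 <= t -> xs (t + 2 * PI) = xs t) ->
  is_lim (fun t => Rabs (x t - xs t)) p_infty 0 ->
  (forall n, t0 <= s + 2 * INR n * PI -> Rabs (x (s + 2 * INR n * PI)) <= r) ->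
  Rabs (xs s) <= r.
Proof.
intros Hs Hp Hlim Hb.
apply Rnot_lt_le; intros Hlt.
assert (He : 0 < Rabs (xs s) - r) by lra.
apply is_lim_spec in Hlim.
destruct (Hlim (mkposreal _ He)) as [A HA]; simpl in HA.
destruct (multiple_of_period_above (Rmax (A + 1) t0)) as [n Hn].
assert (A + 1 <= 2 * INR n * PI) by (eapply Rle_trans; [apply Rmax_l | exact Hn]).
assert (t0 <= 2 * INR n * PI) by (eapply Rle_trans; [apply Rmax_r | exact Hn]).
specialize (HA (s + 2 * INR n * PI)).
rewrite Rminus_0_r, Rabs_Rabsolu, (periodic_multiple xs) in HA by auto.
assert (HB : Rabs (x (s + 2 * INR n * PI)) <= r) by (apply Hb; lra).
assert (HC : Rabs (x (s + 2 * INR n * PI) - xs s) < Rabs (xs s) - r) by (apply HA; lra).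
rewrite Rabs_minus_sym in HC.
generalize (Rabs_triang_inv (xs s) (x (s + 2 * INR n * PI))); lra.
Qed.

(** At time t0 the periodic solution is a fixed point of the return map, hence
    of modulus at most beta; at other times it has drifted by at most
    2 pi eps H. *)
Lemma periodic_attractor_small (eps a : R) (h h1 h2 h3 x xs : R -> R)
  (t0 r H L c sigma : R) :
  0 < eps -> 0 < a <= 1 -> 0 < r -> 0 < sigma -> 0 <= H ->
  (forall z, is_derive h z (h1 z)) ->
  (forall z, is_derive h1 z (h2 z)) ->
  (forall z, is_derive h2 z (h3 z)) ->
  (forall z, Rabs z <= 2 * r + 2 -> Rabs (h z) <= H) ->
  (forall z, Rabs z <= 3 * r + 2 -> Rabs (h1 z) <= L) ->
  (forall z, Rabs z <= 2 * r + 2 -> Rabs (h3 z) <= c) ->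
  (forall w, 0 < Rabs w <= 2 * r + 1 -> sigma <= h1 w / w) ->
  0 <= t0 ->
  (forall t, t0 <= t -> Rabs (x t) <= 2 * r) ->
  solves (oscillating_field eps a h) (fun t => 0 <= t) xs ->
  (forall t, 0 <= t -> xs (t + 2 * PI) = xs t) ->
  is_lim (fun t => Rabs (x t - xs t)) p_infty 0 ->
  forall t, 0 <= t ->
  Rabs (xs t) <= a ^ 2 * c / (6 * sigma) + 4 * PI * eps * H * L / (a * sigma)
                 + 2 * PI * eps * H.
Proof.
intros He Ha Hr Hsig H0 Hh Hh1 Hh2 HH HL Hc Hslope Ht0 Hx Hxs Hp Hlim.
assert (HP := PI_RGT_0).
assert (H2r : forall t, 0 <= t -> Rabs (xs t) <= 2 * r).
{ intros t Ht; apply (periodic_limit_bound x xs t0); auto. }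
set (beta := a ^ 2 * c / (6 * sigma) + 4 * PI * eps * H * L / (a * sigma)).
assert (Hb : Rabs (xs t0) <= beta).
{ destruct (return_map eps a h h1 h2 h3 xs t0 r H L c sigma) as [Up Down]; auto.
  - intros t Ht; apply Hxs; lra.
  - intros t Ht; apply H2r; lra.
  - fold beta in Up, Down; rewrite Hp in Up, Down by exact Ht0.
    apply Rabs_le; split; apply Rnot_lt_le; intros Hlt;
      [specialize (Down Hlt) | specialize (Up Hlt)]; lra. }
intros t Ht.
destruct (multiple_of_period_above t0) as [n Hn].
assert (Hd : 0 <= t + 2 * INR n * PI - t0) by lra.
destruct (period_decomposition _ Hd) as [k [s [Hs Es]]].
rewrite <- (periodic_multiple xs n t) by auto.
replace (t + 2 * INR n * PI) with (t0 + s + 2 * INR k * PI) by lra.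
rewrite (periodic_multiple xs k) by (auto; lra).
assert (D : Rabs (xs (t0 + s) - xs t0) <= 2 * PI * eps * H).
{ apply (solution_drift eps a h); auto; [lra | |].
  - intros q Hq; apply Hxs; lra.
  - intros q Hq; apply HH.
    eapply Rle_trans; [apply Rabs_shift_le; [|apply H2r]; lra | lra]. }
apply Rabs_le_between in D; apply Rabs_le_between in Hb; apply Rabs_le; lra.
Qed.

(** * Small periodic solutions and the choice of constants *)

Lemma max_over_period (x X : R -> R) :
  (forall t, 0 <= t -> X t = x t) ->
  (forall t, 0 <= t -> continuous X t) ->
  is_max_over (fun t => 0 <= t <= 2 * PI) (fun t => Rabs (x t))
    (max_over (fun t => 0 <= t <= 2 * PI) (fun t => Rabs (x t))).
Proof.
intros HX Hc; apply max_over_segment; [generalize PI_RGT_0; lra|].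
intros t Ht e He.
assert (HXt := Hc t (proj1 Ht)).
apply continuity_pt_filterlim in HXt.
destruct (HXt e He) as [d [Hd Hlim]].
exists d; split; [exact Hd|].
intros s [[Hs Hst] Hsd].
assert (H := Hlim s (conj (conj I Hst) Hsd)).
simpl in *; unfold Rdist in *.
rewrite !HX in H by lra.
eapply Rle_lt_trans; [apply Rabs_triang_inv2 | exact H].
Qed.

Lemma small_periodic_extension (eps a rho : R) (h y : R -> R) :
  is_periodic_solution eps a h y ->
  max_over (fun t => 0 <= t <= 2 * PI) (fun t => Rabs (y t)) <= rho ->
  exists Y, (forall t, 0 <= t -> Y t = y t) /\
    solves (oscillating_field eps a h) (fun t => 0 <= t) Y /\
    (forall t, 0 <= t -> Y (t + 2 * PI) = Y t) /\
    (forall t, 0 <= t -> Rabs (Y t) <= rho).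
Proof.
intros [Hy Py] Hmax.
assert (HP := PI_RGT_0).
destruct (two_sided_ray eps a h y 0 Hy) as [Y [EY HY]].
assert (PY : forall t, 0 <= t -> Y (t + 2 * PI) = Y t)
  by (intros t Ht; rewrite !EY by lra; auto).
exists Y; split; [exact EY | split; [exact HY | split; [exact PY|]]].
intros t Ht; destruct (period_decomposition t Ht) as [k [s [Hs ->]]].
rewrite (periodic_multiple Y) by (auto; lra).
destruct (max_over_period y Y EY) as [_ Hle].
- intros q Hq; apply (ex_derive_continuous Y); eexists; apply (HY q Hq).
- rewrite EY by lra; eapply Rle_trans; [apply (Hle s Hs) | exact Hmax].
Qed.

Lemma global_unique (eps a : R) (h h1 x y : R -> R) (t0 T : R) :
  0 < eps -> 0 < a ->
  (forall z, is_derive h z (h1 z)) -> (forall z, continuous h1 z) ->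
  solves (oscillating_field eps a h) (fun t => t0 <= t) x ->
  is_solution eps a h (fun t => t0 <= t < T) y ->
  y t0 = x t0 -> forall t, t0 <= t < T -> y t = x t.
Proof.
intros He Ha Hh Hc Hx Hy E t Ht.
destruct (two_sided_interval eps a h y t0 T Hy) as [Y [EY HY]].
rewrite <- EY by lra.
apply (solution_unique eps a h h1 Y x t0 t); auto; try lra.
- intros s Hs; apply HY; lra.
- intros s Hs; apply Hx; lra.
- rewrite EY by lra; exact E.
Qed.

(** The conclusion amounts to q (q + 3 sigma) < 6 sigma b with q = a c.
    Multiplied by 3 sigma pi, it follows from the hypothesis by q <= c and
    pi <= 4, after discarding the terms 12 sigma b and c^2. *)
Lemma contraction_margin (a c sigma b : R) :
  0 < a <= 1 -> 0 <= c -> 0 < sigma ->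
  a * c * (12 * sigma * b + (c + 6 * sigma) ^ 2) < 18 * sigma ^ 2 * b * PI ->
  0 < b ->
  0 < b - c * (a ^ 2 * c / (6 * sigma)) - c * a / 2.
Proof.
intros [Ha Ha1] Hc Hs Hineq Hb.
assert (P4 := PI_4); assert (HP := PI_RGT_0).
set (q := a * c).
assert (q0 : 0 <= q) by (apply Rmult_le_pos; lra).
assert (Q1 : q <= c) by (unfold q; nra).
assert (G : q * (q + 3 * sigma) < 6 * sigma * b).
{ apply Rmult_lt_reg_l with (3 * sigma * PI).
  { apply Rmult_lt_0_compat; lra. }
  replace (3 * sigma * PI * (6 * sigma * b)) with (18 * sigma ^ 2 * b * PI) by ring.
  eapply Rle_lt_trans; [|exact Hineq]; fold q.
  apply Rle_trans with (q * (12 * sigma * (c + 3 * sigma))).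
  - replace (3 * sigma * PI * (q * (q + 3 * sigma)))
      with (q * (3 * sigma * (PI * (q + 3 * sigma)))) by ring.
    replace (12 * sigma * (c + 3 * sigma)) with (3 * sigma * (4 * (c + 3 * sigma))) by ring.
    apply Rmult_le_compat_l; [exact q0|].
    apply Rmult_le_compat_l; [lra|].
    apply Rmult_le_compat; try lra; nra.
  - apply Rmult_le_compat_l; [exact q0|].
    assert (0 <= sigma * b) by nra.
    assert (0 <= c ^ 2) by apply pow2_ge_0.
    nra. }
replace (b - c * (a ^ 2 * c / (6 * sigma)) - c * a / 2)
  with ((6 * sigma * b - q * (q + 3 * sigma)) / (6 * sigma))
  by (unfold q; field; lra).
apply Rdiv_lt_0_compat; lra.
Qed.

Lemma drift_constant (eps a sigma H L : R) :
  0 < eps -> 0 < a -> 0 < sigma -> 0 <= H -> 0 <= L ->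
  4 * PI * eps * H * L / (a * sigma) + 2 * PI * eps * H
  <= eps * (8 * H * (2 / (a * sigma) * L + 1)).
Proof.
intros He Ha Hs HH HL.
assert (P4 := PI_4); assert (HP := PI_RGT_0).
assert (A0 : 0 < a * sigma) by (apply Rmult_lt_0_compat; lra).
set (q := eps * H * L / (a * sigma)).
assert (E0 : 0 <= eps * H) by (apply Rmult_le_pos; lra).
assert (q0 : 0 <= q).
{ apply Rdiv_le_0_compat; [apply Rmult_le_pos; lra | exact A0]. }
replace (4 * PI * eps * H * L / (a * sigma)) with (4 * PI * q) by (unfold q; field; lra).
replace (eps * (8 * H * (2 / (a * sigma) * L + 1))) with (16 * q + 8 * (eps * H))
  by (unfold q; field; lra).
nra.
Qed.

Theorem theorem4 (a : R) (h : R -> R)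
  (ha : 0 < a)
  (hC3 : class_C 3 h)
  (hsign : forall x : R, x <> 0 -> Derive h x * x > 0)
  (hd0 : Derive h 0 = 0)
  (hdd0 : Derive_n h 2 0 > 0) :
  (forall eps : R, 0 < eps ->
     forall x : R -> R, is_bounded_solution eps a h x ->
       exists xs : R -> R,
         is_periodic_solution eps a h xs /\
         is_lim (fun t => Rabs (x t - xs t)) p_infty 0)
  /\
  (forall r : R, 0 < r ->
     is_min_over (fun w => Rabs w <= 2 * r + 1)
       (fun w => RInt (fun l => Derive_n h 2 (l * w)) 0 1) (sigma_h h r) /\
     sigma_h h r > 0 /\
     (a <= 1 ->
      a * gamma_h h r *
        (12 * sigma_h h r * Derive_n h 2 0 + (gamma_h h r + 6 * sigma_h h r) ^ 2)
        < 18 * sigma_h h r ^ 2 * Derive_n h 2 0 * PI ->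
      a ^ 2 * gamma_h h r < 6 * sigma_h h r * r ->
      exists epsstar : R, 0 < epsstar /\
        forall eps : R, 0 < eps < epsstar ->
          let small_periodic (x : R -> R) :=
            is_periodic_solution eps a h x /\
            max_over (fun t => 0 <= t <= 2 * PI) (fun t => Rabs (x t))
              <= a ^ 2 * gamma_h h r / (6 * sigma_h h r) + eps * K_h h a r in
          exists xss : R -> R,
            small_periodic xss /\
            (forall y : R -> R, small_periodic y ->
               forall t : R, 0 <= t -> y t = xss t) /\
            (forall t0 x0 : R, 0 <= t0 -> Rabs x0 <= r ->
               exists x : R -> R,
                 is_solution eps a h (fun t => t0 <= t) x /\
                 x t0 = x0 /\
                 (forall (T : R) (y : R -> R),
                    is_solution eps a h (fun t => t0 <= t < T) y ->
                    y t0 = x0 ->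
                    forall t : R, t0 <= t < T -> y t = x t) /\
                 is_lim (fun t => Rabs (x t - xss t)) p_infty 0))).
Proof.
destruct hC3 as [Hex Hcont].
set (h1 := Derive h) in *; set (h2 := Derive_n h 2) in *; set (h3 := Derive_n h 3) in *.
assert (Hh : forall z, is_derive h z (h1 z)).
{ intros z; apply Derive_correct, (Hex 1%nat z); lia. }
assert (Hh1 : forall z, is_derive h1 z (h2 z)).
{ intros z; apply Derive_correct, (Hex 2%nat z); lia. }
assert (Hh2 : forall z, is_derive h2 z (h3 z)).
{ intros z; apply Derive_correct, (Hex 3%nat z); lia. }
assert (Ch : forall z, continuous h z)
  by (intros z; apply (ex_derive_continuous h); eexists; apply Hh).
assert (Ch1 : forall z, continuous h1 z)
  by (intros z; apply (ex_derive_continuous h1); eexists; apply Hh1).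
assert (Ch2 : forall z, continuous h2 z)
  by (intros z; apply (ex_derive_continuous h2); eexists; apply Hh2).
assert (HP := PI_RGT_0).
split.
- intros eps He x [t0 [Ht0 [Hx [M HM]]]].
  destruct (two_sided_ray eps a h x t0 Hx) as [X [EX HX]].
  destruct (bounded_solution_converges eps a h h1 X t0 M) as [xs [Hxs [Pxs Hlim]]]; auto.
  { intros t Ht; rewrite EX by exact Ht; auto. }
  exists xs; split.
  + split; [apply is_solution_of_solves, Hxs | exact Pxs].
  + apply is_lim_ext_loc with (2 := Hlim).
    exists t0; intros t Ht; rewrite EX by lra; reflexivity.
- intros r Hr.
  assert (Hmin := sigma_h_min h h2 r Hh1 hd0 Hr); fold h1 in Hmin.
  assert (Hsig : 0 < sigma_h h r).
  { destruct Hmin as [[w [_ <-]] _].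
    destruct (Req_dec w 0) as [->|Hw]; [rewrite slope_0; exact hdd0|].
    rewrite slope_neq_0 by exact Hw.
    replace (h1 w / w) with (h1 w * w / w ^ 2) by (field; exact Hw).
    apply Rdiv_lt_0_compat; [apply hsign, Hw | apply pow2_gt_0, Hw]. }
  split; [|split; [exact Hsig|]].
  { destruct Hmin as [[w [Hw Ew]] Hle]; split.
    - exists w; split; [exact Hw|]; rewrite RInt_slope with (f := h1); auto.
    - intros z Hz; rewrite RInt_slope with (f := h1); auto. }
  intros ha1 Hineq Hsize.
  set (sigma := sigma_h h r) in *; set (c := gamma_h h r) in *.
  assert (Hslope : forall w, 0 < Rabs w <= 2 * r + 1 -> sigma <= h1 w / w).
  { intros w [Hw Hwr]; rewrite <- (slope_neq_0 h1 (h2 0)).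
    - apply (proj2 Hmin), Hwr.
    - intros ->; rewrite Rabs_R0 in Hw; lra. }
  assert (Hmax : forall f rho, 0 <= rho -> (forall z, continuous f z) -> forall z, Rabs z <= rho ->
            Rabs (f z) <= max_over (fun z => Rabs z <= rho) (fun z => Rabs (f z))).
  { intros f rho Hrho Hf; apply (max_over_ball rho (fun z => Rabs (f z)) Hrho).
    intros z; apply (continuous_comp f Rabs); [apply Hf | apply continuous_Rabs]. }
  assert (Hc : forall z, Rabs z <= 2 * r + 2 -> Rabs (h3 z) <= c)
    by (apply Hmax; [lra | exact Hcont]).
  unfold K_h; fold h1 sigma.
  assert (HH := Hmax h (2 * r + 2) ltac:(lra) Ch).
  assert (HL := Hmax h1 (3 * r + 2) ltac:(lra) Ch1).
  set (H := max_over _ (fun z => Rabs (h z))) in *.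
  set (L := max_over _ (fun z => Rabs (h1 z))) in *.
  set (K := 8 * H * (2 / (a * sigma) * L + 1)).
  assert (Z0 : forall q, 0 <= q -> Rabs 0 <= q) by (intros q Hq; rewrite Rabs_R0; exact Hq).
  assert (H0 : 0 <= H).
  { eapply Rle_trans; [apply Rabs_pos | apply (HH 0), Z0; lra]. }
  assert (L0 : 0 <= L).
  { eapply Rle_trans; [apply Rabs_pos | apply (HL 0), Z0; lra]. }
  assert (c0 : 0 <= c).
  { eapply Rle_trans; [apply Rabs_pos | apply (Hc 0), Z0; lra]. }
  destruct (bounded_on_ball h2 (2 * r + 2) Ch2) as [L2 [L20 HL2]].
  assert (K0 : 0 <= K).
  { unfold K; apply Rmult_le_pos; [lra|].
    apply Rplus_le_le_0_compat; [|lra]; apply Rmult_le_pos; [|exact L0].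
    apply Rdiv_le_0_compat; [lra | apply Rmult_lt_0_compat; lra]. }
  set (B := a ^ 2 * c / (6 * sigma)).
  assert (B0 : 0 <= B).
  { apply Rdiv_le_0_compat; [apply Rmult_le_pos; [apply pow2_ge_0 | exact c0] | lra]. }
  assert (Br : B < r).
  { apply Rmult_lt_reg_l with (6 * sigma); [lra|].
    replace (6 * sigma * B) with (a ^ 2 * c) by (unfold B; field; lra); exact Hsize. }
  assert (Hkappa := contraction_margin a c sigma (h2 0) (conj ha ha1) c0 Hsig Hineq hdd0).
  fold B in Hkappa; set (kappa := h2 0 - c * B - c * a / 2) in *.
  set (C := L2 * H + 2 * L ^ 2).
  assert (C0 : 0 <= C).
  { unfold C; apply Rplus_le_le_0_compat; [apply Rmult_le_pos; lra|].
    apply Rmult_le_pos; [lra | apply pow2_ge_0]. }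
  (* eps K <= r - B keeps rho below r, and eps W < a kappa keeps the contraction
     at rho = B + eps K *)
  set (W := a * c * K + 2 * C).
  assert (W0 : 0 <= W).
  { unfold W; assert (0 <= a * c) by (apply Rmult_le_pos; lra).
    assert (0 <= a * c * K) by (apply Rmult_le_pos; lra); lra. }
  exists (Rmin ((r - B) / (K + 1)) (a * kappa / (W + 1))); split.
  { apply Rmin_glb_lt; apply Rdiv_lt_0_compat; try lra; apply Rmult_lt_0_compat; lra. }
  intros eps [He Heps].
  set (small_periodic := fun x : R -> R => is_periodic_solution eps a h x /\
    max_over (fun t => 0 <= t <= 2 * PI) (fun t => Rabs (x t)) <= B + eps * K).
  assert (E1 : eps * K <= r - B).
  { assert (E : eps < (r - B) / (K + 1)) by (eapply Rlt_le_trans; [exact Heps | apply Rmin_l]).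
    apply Rmult_lt_compat_r with (r := K + 1) in E; [|lra].
    replace ((r - B) / (K + 1) * (K + 1)) with (r - B) in E by (field; lra); lra. }
  assert (E2 : eps * W < a * kappa).
  { assert (E : eps < a * kappa / (W + 1)) by (eapply Rlt_le_trans; [exact Heps | apply Rmin_r]).
    apply Rmult_lt_compat_r with (r := W + 1) in E; [|lra].
    replace (a * kappa / (W + 1) * (W + 1)) with (a * kappa) in E by (field; lra); lra. }
  assert (HK := drift_constant eps a sigma H L He ha Hsig H0 L0); fold K in HK.
  set (rho := B + eps * K) in *.
  assert (Hrho : B + 4 * PI * eps * H * L / (a * sigma) + 2 * PI * eps * H <= rho)
    by (unfold rho; lra).
  assert (rhor : rho <= r) by (unfold rho; lra).
  assert (Hcontr : 2 * eps * C < a * (h2 0 - c * rho - c * a / 2)).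
  { unfold rho; replace (a * (h2 0 - c * (B + eps * K) - c * a / 2))
      with (a * kappa - eps * (a * c * K)) by (unfold kappa; ring).
    unfold W in E2; lra. }
  assert (Attract : forall t0 x0, 0 <= t0 -> Rabs x0 <= r -> exists x xs,
    x t0 = x0 /\ solves (oscillating_field eps a h) (fun t => t0 <= t) x /\
    small_periodic xs /\ is_lim (fun t => Rabs (x t - xs t)) p_infty 0).
  { intros t0 x0 Ht0 Hx0.
    destruct (trapped_solution eps a h h1 h2 h3 t0 x0 r H L c sigma)
      as [x [Ex [Hx Hxr]]]; auto; [fold B; lra|].
    destruct (bounded_solution_converges eps a h h1 x t0 (2 * r))
      as [xs [Hxs [Pxs Hlim]]]; auto.
    exists x, xs; split; [exact Ex | split; [exact Hx | split; [|exact Hlim]]].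
    split; [split; [|exact Pxs]|].
    - apply is_solution_of_solves, Hxs.
    - destruct (max_over_period xs xs) as [[z [Hz <-]] _]; auto.
      { intros t Ht; apply (ex_derive_continuous xs); eexists; apply (Hxs t Ht). }
      eapply Rle_trans; [|exact Hrho].
      apply (periodic_attractor_small eps a h h1 h2 h3 x xs t0 r H L c sigma); auto; lra. }
  assert (Unique : forall y z, small_periodic y -> small_periodic z ->
            forall t, 0 <= t -> y t = z t).
  { intros y z [Py My] [Pz Mz] t Ht.
    destruct (small_periodic_extension eps a rho h y Py My) as [Y [EY [HY [PY RY]]]].
    destruct (small_periodic_extension eps a rho h z Pz Mz) as [Z [EZ [HZ [PZ RZ]]]].
    rewrite <- EY, <- EZ by exact Ht.
    apply (small_periodic_unique eps a h h1 h2 h3 Y Z rho H L L2 c); auto;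
      intros w Hw; [apply HH | apply HL | apply HL2 | apply Hc]; lra. }
  (* any initial condition in the ball leads to the periodic solution *)
  destruct (Attract 0 0) as [_ [xss [_ [_ [Hxss _]]]]]; [lra | apply Z0; lra |].
  exists xss; split; [exact Hxss | split].
  + intros y Hy; apply Unique; assumption.
  + intros t0 x0 Ht0 Hx0.
    destruct (Attract t0 x0 Ht0 Hx0) as [x [xs [Ex [Hx [Hxs Hlim]]]]].
    exists x; split; [apply is_solution_of_solves, Hx | split; [exact Ex | split]].
    * intros T y Hy Ey; rewrite <- Ex in Ey.
      apply (global_unique eps a h h1 x y t0 T); auto.
    * apply is_lim_ext_loc with (2 := Hlim).
      exists 0; intros t Ht; rewrite (Unique xs xss) by (auto; lra); reflexivity.
Qed.
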